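(* If $K$ is a planar convex body, then $\mathrm{coin}(K)\le\mathrm{coin}(B^2)=14$.
   Context: A planar convex body is a compact convex subset of the Euclidean plane $\mathbb{E}^2$ with nonempty interior. $B^2$ denotes a circular disk (2-dimensional ball). For a planar convex body $K$ and $m\in\mathbb{N}=\{1,2,\dots\}$, $\gamma_m(K)=\inf\{\lambda>0:K\subseteq\bigcup_{i=1}^m(\lambda K+t_i),\ t_i\in\mathbb{E}^2\}$. The covering index of $K$ is $$\mathrm{coin}(K)=\inf\left\{\frac{m}{1-\gamma_m(K)}:\gamma_m(K)\le\tfrac12,\ m\in\mathbb{N}\right\}.$$ *)

(* Defs.v *)
From mathcomp Require Import all_boot all_order all_algebra.
From mathcomp Require Import all_classical all_reals all_analysis.

Set Implicit Arguments.
Unset Strict Implicit.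
Unset Printing Implicit Defensive.

Import Order.TTheory GRing.Theory Num.Theory.
Import numFieldNormedType.Exports.

Local Open Scope classical_set_scope.
Local Open Scope ring_scope.

(* The library norm on ['rV[R]_2] is the sup norm; only the topology it induces,
   which is the Euclidean one, is used below. *)
Definition planar_convex_body (R : realType) (K : set 'rV[R]_2) : Prop :=
  [/\ compact K, convex_set K & interior K !=set0].

Definition disk (R : realType) (c : 'rV[R]_2) (r : R) : set 'rV[R]_2 :=
  [set x | Num.sqrt (\sum_(i < 2) (x ord0 i - c ord0 i) ^+ 2) <= r].

Definition homothet (R : realType) (K : set 'rV[R]_2) (l : R) (t : 'rV[R]_2) :
    set 'rV[R]_2 :=
  [set l *: x + t | x in K].

(* The set is bounded below by 0 and, for [0 < m], contains 1, so that the real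
   infimum [inf] is the genuine one; [m = 0] is excluded in [coin]. *)
Definition gamma (R : realType) (m : nat) (K : set 'rV[R]_2) : R :=
  inf [set l : R | 0 < l /\
    exists t : 'I_m -> 'rV[R]_2,
      K `<=` \bigcup_(i in [set: 'I_m]) homothet K l (t i)].

(* Extended-real infimum, so that the infimum of the empty set is [+oo]. *)
Definition coin (R : realType) (K : set 'rV[R]_2) : \bar R :=
  ereal_inf [set (m%:R / (1 - gamma m K))%:E | m in
    [set m : nat | (0 < m)%N /\ gamma m K <= 1 / 2]].

(* Main.v *)
Require Import Defs.
From mathcomp Require Import all_boot all_order all_algebra.
From mathcomp Require Import all_classical all_reals all_analysis.
From mathcomp Require Import ring lra.
Set Implicit Arguments.
Unset Strict Implicit.
Unset Printing Implicit Defensive.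
Import Order.TTheory GRing.Theory Num.Theory.
Import numFieldNormedType.Exports.
Local Open Scope classical_set_scope.
Local Open Scope ring_scope.

(** The number 14 is 7 / (1 - 1/2).  It bounds coin K for every K because
    seven translates of K/2 cover K (Levi), and it cannot be lowered for the
    disk because no number m of translates does better there.

    Levi's covering.  Suppose that K contains an affine regular hexagon that
    it does not leave except inside the six triangles cut off by the extended
    sides ([tight], [right_star], [top_star]).  Then the translate of K/2 at
    the centre and the six at the midpoints of the sides cover K.  Indeed, let
    the centre be the origin and let x lie in the triangle on a side, with
    apex e.  Then x is in the copy at the midpoint e/2 of this side if 2 x - e
    is in K, and 2 x - e lies in the convex hull of x and of the hexagon
    ([sector_cover]).

    Such a hexagon comes from an extremal problem.  For a direction u consider
    hexagons inscribed in K with two sides h u, exchanged by a half turn, and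
    with a diagonal 2 h u lying halfway between them, but possibly slid along
    itself by a vector d u; take one of maximal area.  If K had a chord
    parallel to u of length h beyond one of the two sides, or of length more
    than 2 h on the line of the diagonal, that chord would produce a hexagon
    of larger area ([optimal_no_higher_chord], [optimal_no_longer_chord]); so
    if d = 0 the hexagon is affine regular and K stays in the star.  To
    reach d = 0, turn u to its opposite, which changes the sign of d.  The
    maximizers depend on u through a closed graph ([optimal_closed]) and for
    fixed u they form a convex set, since the area is a product of two
    nonnegative affine functions ([mix_optimal]); connectedness of the
    interval of directions then yields a maximizer with d = 0
    ([balanced_exists]).

    The disk.  Let m disks of radius l cover the unit disk.  The one that
    covers the centre meets the unit circle in a short arc at most, so the
    others cover the rest of the circle.  Inscribe a regular n-gon with side
    larger than 2 l, where n >= m - 1, and turn it.  Each disk contains at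
    most one vertex, hence exactly one, and by connectedness it follows that
    vertex all the way, until it is too far from where it started
    ([rotating_polygon]).  For 7 <= m <= 13 and n = m - 1 this excludes
    l < 1 - m / 14, because sin (pi / n) >= 3 / n >= (13 - n) / 14; both
    inequalities are equalities at n = 6.  For m <= 6 a pentagon excludes
    every l up to some number above 1/2.  For m >= 14 the bound
    follows from gamma >= 0. *)

(** * Continuity and filters *)

Lemma near_forall_seq (T : Type) (F : set_system T) (I : eqType) (s : seq I)
    (P : I -> T -> Prop) : Filter F ->
  (forall i, i \in s -> \forall x \near F, P i x) ->
  \forall x \near F, forall i, i \in s -> P i x.
Proof.
move=> FF; elim: s => [|i s IHs] Ps; first by apply: nearW => x i; rewrite in_nil.
have Pi : \forall x \near F, P i x by apply: Ps; rewrite mem_head.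
have {}IHs := IHs (fun j js => Ps j (mem_behead (s := i :: s) js)).
by apply: filterS2 Pi IHs => x Px Psx j; rewrite inE => /predU1P[->//|/Psx].
Qed.

Lemma cont_fst (X A B : topologicalType) (f : X -> A * B) :
  continuous f -> continuous (fun x => (f x).1).
Proof. by move=> cf x; apply: (cvg_comp _ _ (cf x)); exact: cvg_fst. Qed.

Lemma cont_snd (X A B : topologicalType) (f : X -> A * B) :
  continuous f -> continuous (fun x => (f x).2).
Proof. by move=> cf x; apply: (cvg_comp _ _ (cf x)); exact: cvg_snd. Qed.

Lemma cont_pair (X A B : topologicalType) (f : X -> A) (g : X -> B) :
  continuous f -> continuous g -> continuous (fun x => (f x, g x)).
Proof. by move=> cf cg x; apply: cvg_pair; [exact: cf|exact: cg]. Qed.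

Lemma cont_comp (X A B : topologicalType) (f : X -> A) (g : A -> B) :
  continuous f -> continuous g -> continuous (fun x => g (f x)).
Proof. by move=> cf cg x; apply: continuous_comp; [exact: cf|exact: cg]. Qed.

Lemma cont_mul (R : realType) (X : topologicalType) (f g : X -> R) :
  continuous f -> continuous g -> continuous (fun x => f x * g x).
Proof. by move=> cf cg x; apply: cvgM; [exact: cf|exact: cg]. Qed.

Lemma cont_sub (R : realType) (X : topologicalType) (f g : X -> R) :
  continuous f -> continuous g -> continuous (fun x => f x - g x).
Proof. by move=> cf cg x; apply: cvgB; [exact: cf|exact: cg]. Qed.

Section Continuity.
Variables (R : realType) (V : normedModType R).

Lemma affine_cont (a : R) (b : V) : continuous (fun y : V => a *: (y - b)).
Proof.
move=> p; apply: cvgZ; first exact: cvg_cst.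
by apply: cvgB; [exact: cvg_id|exact: cvg_cst].
Qed.

Lemma vertex_map_cont (a b c : R) :
  continuous (fun z : V * (V * V * R * R) =>
    z.2.1.1.1 + a *: z.2.1.1.2 + (b * z.2.1.2 + c * z.2.2) *: z.1).
Proof.
have c0 : continuous (fun z : V * (V * V * R * R) => z.2).
  by apply: cont_snd => ?; exact: cvg_id.
have c1 := cont_fst c0; have c2 := cont_fst c1.
move=> z; apply: cvgD; first apply: cvgD.
- exact: (cont_fst c2).
- by apply: cvgZ; [exact: cvg_cst|exact: (cont_snd c2)].
- apply: cvgZ; last exact: cvg_fst.
  apply: cvgD; apply: cvgM;
    [exact: cvg_cst|exact: (cont_snd c1)|exact: cvg_cst|exact: (cont_snd c0)].
Qed.

End Continuity.

(** * Inscribed hexagons with sides along a given direction *)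

Local Notation centre w := (w.1.1.1) (only parsing).
Local Notation rise w := (w.1.1.2) (only parsing).
Local Notation skew w := (w.1.2) (only parsing).
Local Notation side w := (w.2) (only parsing).

Section Hexagons.
Variable R : realType.
Notation V := 'rV[R]_2.
Implicit Types (K : set V) (x y u : V).

(** Convexity with plain real weights, so that [ring] and [lra] apply to them. *)
Definition convex_pts K := forall x y (t : R), K x -> K y -> 0 <= t <= 1 ->
  K ((1 - t) *: x + t *: y).

Lemma convex_set_pts K : convex_set K -> convex_pts K.
Proof.
move=> cK x y t Kx Ky /andP[t0 t1].
have := cK y x (Itv01 t0 t1) (mem_set Ky) (mem_set Kx).
by rewrite inE /= addrC.
Qed.

(** The homothety with centre [x] and ratio [t] maps a neighbourhood of [c] in
    [K] to a neighbourhood of the image point, inside [K] by convexity. *)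
Lemma interior_shrink K x c (t : R) : convex_pts K -> K x -> K° c -> 0 < t <= 1 ->
  K° ((1 - t) *: x + t *: c).
Proof.
move=> cK Kx Kc /andP[t0 t1].
pose f (y : V) : V := t^-1 *: (y - (1 - t) *: x).
have fc : f ((1 - t) *: x + t *: c) = c.
  by rewrite /f addrAC subrr add0r scalerA mulVf ?scale1r ?gt_eqF.
have ctf : f @ ((1 - t) *: x + t *: c) --> f ((1 - t) *: x + t *: c).
  exact: affine_cont.
have : \forall y \near (1 - t) *: x + t *: c, K (f y).
  by move: ctf; rewrite fc => /(_ K Kc).
rewrite /interior; apply: filterS => y Kfy.
have -> : y = (1 - t) *: x + t *: f y.
  by rewrite /f scalerA mulfV ?scale1r ?gt_eqF// addrC subrK.
by apply: cK => //; rewrite ltW.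
Qed.

(** For fixed [u] this linear form is the signed height over the line spanned by
    [u], times the length of [u]. *)
Definition cross u x : R := u 0 0 * x 0 1 - u 0 1 * x 0 0.

Lemma crossD u x y : cross u (x + y) = cross u x + cross u y.
Proof. by rewrite /cross !mxE; ring. Qed.

Lemma crossZ u (a : R) x : cross u (a *: x) = a * cross u x.
Proof. by rewrite /cross !mxE; ring. Qed.

Lemma crossN u x : cross u (- x) = - cross u x.
Proof. by rewrite /cross !mxE; ring. Qed.

Lemma crossuu u : cross u u = 0.
Proof. by rewrite /cross; ring. Qed.

Lemma cross_cont : continuous (fun z : V * V => cross z.1 z.2).
Proof.
have c i : continuous (fun x : V => x 0 i) by exact: coord_continuous.
have c1 i : continuous (fun z : V * V => z.1 0 i).
  by apply: cont_comp (c i); apply: cont_fst => ?; exact: cvg_id.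
have c2 i : continuous (fun z : V * V => z.2 0 i).
  by apply: cont_comp (c i); apply: cont_snd => ?; exact: cvg_id.
by apply: cont_sub; apply: cont_mul.
Qed.

(** The tuple (g, v, d, h), read with [centre], [rise], [skew] and [side],
    stands for the hexagon with vertices g + v +- (h/2) u, g - v +- (h/2) u and
    g + d u +- h u.  It is affine regular when d = 0.  A tuple inherits the
    product topology and the linear structure used below; the vertices are
    affine functions of it. *)
Definition hexagon := (V * V * R * R)%type.

Definition vertex u (w : hexagon) (c : R * R * R) : V :=
  (centre w) + c.1.1 *: rise w + (c.1.2 * skew w + c.2 * side w) *: u.

(** The code (a, b, e) denotes the vertex g + a v + (b d + e h) u. *)
Definition vertex_codes : seq (R * R * R) :=
  [:: (1, 0, 1 / 2); (1, 0, - (1 / 2)); (-1, 0, 1 / 2); (-1, 0, - (1 / 2));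
      (0, 1, 1); (0, 1, -1)].

(** The area proper is three times this number: the hexagon consists of two
    trapezoids with parallel sides h u and 2 h u. *)
Definition third_area u (w : hexagon) := (side w) * cross u (rise w).

Definition inscribed K u (w : hexagon) := [/\ 0 <= side w, 0 <= cross u (rise w) &
  forall c, c \in vertex_codes -> K (vertex u w c)].

Lemma third_area_gt0 K u w : inscribed K u w -> 0 < third_area u w ->
  0 < side w /\ 0 < cross u (rise w).
Proof.
move=> [h0 v0 _]; rewrite /third_area => area0.
by split; rewrite lt_def ?h0 ?v0 andbT; apply: contraTneq area0 => ->;
  rewrite ?mulr0 ?mul0r ltxx.
Qed.

Definition optimal K u w := inscribed K u w /\
  forall w', inscribed K u w' -> third_area u w' <= third_area u w.

Let T := (V * hexagon)%type.

Lemma vertex_cont c : continuous (fun z : T => vertex z.1 z.2 c).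
Proof. exact: vertex_map_cont. Qed.

Lemma rise_cont : continuous (fun z : T => cross z.1 (rise z.2)).
Proof.
have c0 : continuous (fun z : T => z.2) by apply: cont_snd => ?; exact: cvg_id.
have c3 := cont_snd (cont_fst (cont_fst c0)).
apply: (cont_comp (f := fun z : T => (z.1, rise z.2))) cross_cont.
by apply: cont_pair c3; apply: cont_fst => ?; exact: cvg_id.
Qed.

Lemma third_area_cont : continuous (fun z : T => third_area z.1 z.2).
Proof.
apply: cont_mul rise_cont.
by do 2 apply: cont_snd; move=> ?; exact: cvg_id.
Qed.

Lemma inscribed_closed K : closed K -> closed [set z : T | inscribed K z.1 z.2].
Proof.
move=> clK.
have c0 : continuous (fun z : T => side z.2).
  by do 2 apply: cont_snd; move=> ?; exact: cvg_id.
have -> : [set z : T | inscribed K z.1 z.2] =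
   ((fun z : T => side z.2) @^-1` [set x | 0 <= x]) `&`
   ((fun z : T => cross z.1 (rise z.2)) @^-1` [set x | 0 <= x]) `&`
   \bigcap_(c in [set` vertex_codes]) ((fun z : T => vertex z.1 z.2 c) @^-1` K).
  apply/seteqP; split => z.
    by case=> h0 c0' hK; split=> // c; exact: hK.
  by case=> -[h0 c0'] hK; split=> // c; exact: hK.
apply: closedI; first apply: closedI.
- by apply: closed_comp (@closed_ge _ _) => ? _; exact: c0.
- by apply: closed_comp (@closed_ge _ _) => ? _; exact: rise_cont.
- by apply: closed_bigI => c _; apply: closed_comp clK => ? _; exact: vertex_cont.
Qed.

Definition shrink (c : V) (t : R) (w : hexagon) : hexagon :=
  ((1 - t) *: centre w + t *: c, (1 - t) *: rise w, (1 - t) * skew w,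
   (1 - t) * side w).

Lemma vertex_shrink u w c t i :
  vertex u (shrink c t w) i = (1 - t) *: vertex u w i + t *: c.
Proof. by apply/rowP => j; rewrite /vertex !mxE /=; ring. Qed.

Lemma third_area_shrink u w c t : third_area u (shrink c t w) = (1 - t) ^+ 2 * third_area u w.
Proof. by rewrite /third_area crossZ /=; ring. Qed.

(** A better competitor at the limit direction can be shrunk slightly towards
    an interior point of [K] and stay better.  Its vertices are then interior,
    so it is still inscribed, and still better, for nearby directions. *)
Lemma optimal_closed K c : convex_pts K -> closed K -> K° c ->
  closed [set z : T | optimal K z.1 z.2].
Proof.
move=> cK clK Kc z clz.
have insz : inscribed K z.1 z.2.
  have sub : [set z : T | optimal K z.1 z.2] `<=` [set z : T | inscribed K z.1 z.2].
    by move=> y [].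
  exact: (inscribed_closed clK (closureS sub clz)).
split=> // w' [h0 v0 w'K]; rewrite leNgt; apply/negP => lt_area.
have area0 : 0 <= third_area z.1 z.2 by case: insz => *; rewrite /third_area mulr_ge0.
have [t t01 ltF] : exists2 t, 0 < t < 1 &
    third_area z.1 z.2 < (1 - t) ^+ 2 * third_area z.1 w'.
  set a := third_area z.1 z.2 in area0 lt_area *; set A := third_area z.1 w' in lt_area *.
  have A0 : 0 < A by lra.
  have tA : (A - a) / (4 * A) * A = (A - a) / 4 by field; lra.
  set t := (A - a) / (4 * A) in tA.
  have t0 : 0 < t by rewrite /t divr_gt0//; lra.
  have t1 : t < 1 by rewrite -(ltr_pM2r A0); lra.
  (* by the choice of t, (1 - 2 t) A is the mean of a and A *)
  exists t; first by rewrite t0 t1.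
  have : 0 <= t * (t * A) by apply: mulr_ge0; [lra|apply: mulr_ge0; lra].
  by rewrite expr2; lra.
have {}v0 : 0 < cross z.1 (rise w').
  have w'K0 : inscribed K z.1 w' by [].
  by have [] := third_area_gt0 w'K0 (le_lt_trans area0 lt_area).
have [h1 t0] : 0 <= (1 - t) * side w' /\ 0 < t <= 1.
  by move/andP: t01 => [t0 t1]; split; [apply: mulr_ge0 => //; lra | lra].
pose w2 := shrink c t w'.
have c12 : continuous (fun y : T => (y.1, w2)).
  by apply: cont_pair; [apply: cont_fst => ?; exact: cvg_id|exact: cst_continuous].
have n1 : \forall y \near z, forall i, i \in vertex_codes -> K (vertex y.1 w2 i).
  apply: (@near_forall_seq _ (nbhs z)) => i ic.
  have : K° (vertex z.1 w2 i).
    by rewrite vertex_shrink; apply: interior_shrink => //; exact: w'K.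
  have /(_ z) cv := @cont_comp _ _ _ _ _ c12 (@vertex_cont i).
  by move=> /cv.
have n2 : \forall y \near z, 0 < cross y.1 (rise w2).
  have /(_ z) := @cont_comp _ _ _ _ _ c12 rise_cont.
  move=> /cvgr_gt; apply; rewrite crossZ mulr_gt0//.
  by move/andP: t01 => []; lra.
have n3 : \forall y \near z, 0 < third_area y.1 w2 - third_area y.1 y.2.
  have /(_ z) := @cont_sub _ _ _ _ (@cont_comp _ _ _ _ _ c12 third_area_cont) third_area_cont.
  by move=> /cvgr_gt; apply; rewrite subr_gt0 third_area_shrink.
have : nbhs z (~` [set z : T | optimal K z.1 z.2]).
  near=> y => -[_ /(_ w2)].
  have ii : inscribed K y.1 w2.
    split => //; first by apply: ltW; near: y.
    by near: y.
  move=> /(_ ii); apply/negP; rewrite -ltNge -subr_gt0; near: y; exact: n3.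
by move=> /clz [y [? ?]].
Unshelve. all: by end_near. Qed.

End Hexagons.

(** * Existence of optimal hexagons with zero skew *)

Section BalancedHexagon.
Variable R : realType.
Notation V := 'rV[R]_2.
Implicit Types (K : set V) (x y u : V) (w : hexagon R).

(** A path from a vector to its opposite.  Its coordinates x and y satisfy
    x^2 + y = 1, so they are not both small. *)
Definition direction (s : R) : V :=
  (1 - 2 * s) *: delta_mx 0 0 + (4 * s * (1 - s)) *: delta_mx 0 1.

Lemma direction_cont : continuous direction.
Proof.
move=> s; apply: (@cvgD _ _ _ (nbhs s)); apply: (@cvgZ _ _ _ (nbhs s));
  try exact: cvg_cst.
  apply: cvgB; first exact: cvg_cst.
  by apply: cvgM; [exact: cvg_cst|exact: cvg_id].
apply: cvgM; first by apply: cvgM; [exact: cvg_cst|exact: cvg_id].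
by apply: cvgB; [exact: cvg_cst|exact: cvg_id].
Qed.

Lemma direction0E s : direction s 0 0 = 1 - 2 * s.
Proof. by rewrite /direction !mxE /=; ring. Qed.

Lemma direction1E s : direction s 0 1 = 4 * s * (1 - s).
Proof. by rewrite /direction !mxE /=; ring. Qed.

Lemma direction1 : direction 1 = - direction 0.
Proof. by rewrite /direction; apply/rowP => j; rewrite !mxE; ring. Qed.

Lemma coord_le_norm x i : `|x 0 i| <= `|x|.
Proof.
rewrite [leRHS]/Num.norm /= mx_normrE.
exact: (le_bigmax _ (fun i : 'I_1 * 'I_2 => `|x i.1 i.2|) (0, i)).
Qed.

Lemma norm_le_coord x M : 0 <= M -> (forall i, `|x 0 i| <= M) -> `|x| <= M.
Proof.
move=> M0 xM; rewrite [leLHS]/Num.norm /= mx_normrE; apply: bigmax_le => // -[i j] _.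
by rewrite (ord1 i).
Qed.

Lemma direction_coord s : 0 <= s <= 1 -> exists i, 1 / 2 <= `|direction s 0 i|.
Proof.
move=> s01; have [h|h] := lerP (1/2) (`|1 - 2 * s|); first by exists 0; rewrite direction0E.
exists 1; rewrite direction1E; move: h; rewrite ltr_norml => /andP[ha hb].
by apply: le_trans (ler_norm _); nra.
Qed.

Lemma direction_neq0 s : 0 <= s <= 1 -> direction s != 0.
Proof.
move=> /direction_coord[i]; apply: contraTneq => ->.
by rewrite mxE normr0 -ltNge; lra.
Qed.

Definition box (M : R) : set (hexagon R) :=
  [set x | `|x| <= M] `*` [set x | `|x| <= M] `*` `[- M, M] `*` `[- M, M].

Lemma norm_le_compact M : compact [set x : V | `|x| <= M].
Proof.
apply: bounded_closed_compact.
  exists M; split; first exact: num_real.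
  move=> N MN x /= xM; exact: le_trans xM (ltW MN).
apply: (@preimage_closed _ _ (fun x : V => `|x|) [set r | r <= M]).
  by move=> x _; exact: norm_continuous.
exact: closed_le.
Qed.

Lemma box_compact M : compact (box M).
Proof.
by repeat apply: compact_setX; try exact: norm_le_compact; exact: segment_compact.
Qed.

Lemma vertex_codesP (P : R * R * R -> Prop) :
  (forall c, c \in vertex_codes R -> P c) <->
  [/\ P (1, 0, 1 / 2) /\ P (1, 0, - (1 / 2)),
      P (-1, 0, 1 / 2) /\ P (-1, 0, - (1 / 2)) &
      P (0, 1, 1) /\ P (0, 1, -1)].
Proof.
split=> [Pc|[[P1 P2] [P3 P4] [P5 P6]] c].
  by do ?split; apply: Pc; rewrite !inE eqxx ?orbT.
by rewrite !inE => /or4P[/eqP->|/eqP->|/eqP->|/or3P[]/eqP->].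
Qed.

Lemma inscribed_box K : compact K -> exists M, forall s w,
  0 <= s <= 1 -> inscribed K (direction s) w -> box M w.
Proof.
move=> /compact_bounded[M0 [_ /(_ (M0 + 1))]] HM0.
have {}HM0 x : K x -> `|x| <= M0 + 1 by move=> Kx; apply: HM0 => //; lra.
set M := M0 + 1 in HM0; exists (8 * M) => s [[[g v] d] h] s01 [h0 v0].
case/vertex_codesP; rewrite /vertex /=.
case=> /HM0 c1 /HM0 c2 [/HM0 c3 /HM0 c4] [/HM0 c5 /HM0 c6].
have M_ge0 : 0 <= M by apply: le_trans c1.
set u := direction s in c1 c2 c3 c4 c5 c6.
have coords i : [/\ `|g 0 i| <= M, `|v 0 i| <= M, `|d * u 0 i| <= 2 * M &
    `|h * u 0 i| <= M].
  have B x : `|x| <= M -> - M <= x 0 i <= M.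
    by rewrite -ler_norml; apply: le_trans; exact: coord_le_norm.
  move: (B _ c1) (B _ c2) (B _ c3) (B _ c4) (B _ c5) (B _ c6); rewrite !mxE.
  rewrite !mulrDl -!mulrA.
  move: (g 0 i) (v 0 i) (d * u 0 i) (h * u 0 i) => gi vi di hi.
  by rewrite !ler_norml => *; split; lra.
have [i ui] := direction_coord s01.
have {ui} scal a : `|a * u 0 i| <= 2 * M -> - (8 * M) <= a <= 8 * M.
  rewrite normrM -ler_norml; move: (`|u 0 i|) ui (normr_ge0 a) => b.
  by nra.
have [_ _ /scal dM hM] := coords i.
split; [split; [split|]|] => /=; rewrite ?in_itv //=.
- by apply: norm_le_coord => [|j]; [lra|have [+ _ _ _] := coords j; lra].
- by apply: norm_le_coord => [|j]; [lra|have [_ + _ _] := coords j; lra].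
- by apply: scal; lra.
Qed.

Lemma ord2 (j : 'I_2) : j = 0 \/ j = 1.
Proof. by case: j => [[|[|j]]] // h; [left|right]; apply/val_inj. Qed.

Lemma near_line K c e : K° c -> \forall t \near (0 : R), K (c + t *: e).
Proof.
move=> Kc; have cf : (fun t : R => c + t *: e) @ (0 : R) --> c.
  rewrite -[X in _ --> X]addr0 -[X in _ + X](scale0r e).
  apply: (@cvgD _ _ _ (nbhs (0 : R))); first exact: cvg_cst.
  by apply: (@cvgZ _ _ _ (nbhs (0 : R))); [exact: cvg_id|exact: cvg_cst].
by move: Kc => /cf.
Qed.

(** Tiny hexagons around an interior point. *)
Lemma inscribed_exists K c u : K° c -> u != 0 ->
  exists2 w, inscribed K u w & 0 < third_area u w.
Proof.
move=> Kc u0.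
pose e : V := (- u 0 1) *: delta_mx 0 0 + u 0 0 *: delta_mx 0 1.
have ue : 0 < cross u e.
  have -> : cross u e = u 0 0 ^+ 2 + u 0 1 ^+ 2.
    by rewrite /cross /e !mxE /=; ring.
  rewrite lt_def addr_ge0 ?sqr_ge0// andbT paddr_eq0 ?sqr_ge0// !sqrf_eq0.
  apply: contra u0 => /andP[/eqP h0 /eqP h1]; apply/eqP/rowP => j.
  by rewrite mxE; case: (ord2 j) => ->.
pose w t : hexagon R := (c, t *: e, 0, t).
have hex t i : vertex u (w t) i = c + t *: (i.1.1 *: e + i.2 *: u).
  by rewrite /vertex /=; apply/rowP => j; rewrite !mxE; ring.
have n1 : \forall t \near 0^'+, forall i, i \in vertex_codes R -> K (vertex u (w t) i).
  apply: near_forall_seq => i _; apply: cvg_within.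
  by under eq_fun do rewrite hex; exact: near_line.
have [t [t0 tK]] : exists t, 0 < t /\ forall i, i \in vertex_codes R -> K (vertex u (w t) i).
  near (0 : R)^'+ => t; exists t; split; first by [].
  by near: t.
exists (w t); last by rewrite /third_area /= crossZ !mulr_gt0.
by split => //=; rewrite ?crossZ ?ltW// mulr_gt0.
Unshelve. all: by end_near. Qed.

Lemma optimal_exists K c s : compact K -> convex_pts K -> K° c -> 0 <= s <= 1 ->
  exists w, optimal K (direction s) w.
Proof.
move=> kK cK Kc s01.
have clK : closed K by apply: compact_closed kK; exact: norm_hausdorff.
have [M boxM] := inscribed_box kK.
have [w0 w0K area0] := inscribed_exists Kc (direction_neq0 s01).
have ci : continuous (fun w => (direction s, w)).
  by apply: cont_pair => [|?]; [exact: cst_continuous|exact: cvg_id].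
have kS : compact [set w | inscribed K (direction s) w].
  apply: subclosed_compact (@box_compact M) _.
    apply: (@preimage_closed _ _ (fun w => (direction s, w))
      [set z : V * hexagon R| inscribed K z.1 z.2]); last exact: inscribed_closed.
    by move=> z _; exact: ci.
  by move=> w; exact: boxM.
have [||w + wmax] := @compact_EVT_max _ _ (third_area (direction s)) _ _ kS.
- by exists w0.
- apply: continuous_subspaceT => w.
  by have /(_ w) := @cont_comp _ _ _ _ _ ci (@third_area_cont R).
rewrite inE => /= wK; exists w; split => // w' w'K.
by apply: wmax; rewrite inE.
Qed.

Lemma optimal_third_area_gt0 K c u w : K° c -> u != 0 -> optimal K u w ->
  0 < third_area u w.
Proof.
move=> Kc u0 [_ wmax]; have [w0 /wmax w0K area0] := inscribed_exists Kc u0.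
exact: lt_le_trans w0K.
Qed.

(** The same hexagon, seen from the opposite direction: top and bottom are
    exchanged and the skew changes sign. *)
Definition flip w : hexagon R := (centre w, - rise w, - skew w, side w).

Lemma flip_inscribed K u w : inscribed K u w -> inscribed K (- u) (flip w).
Proof.
case=> h0 v0 /vertex_codesP wK; split => //=.
  by move: v0; rewrite /cross !mxE; lra.
have hexE c : vertex (- u) (flip w) c = vertex u w (- c.1.1, c.1.2, - c.2).
  by rewrite /vertex /=; apply/rowP => j; rewrite !mxE; ring.
by apply/vertex_codesP; rewrite !hexE /= ?opprK oppr0; case: wK => -[p1 p2] [p3 p4] [p5 p6].
Qed.

Lemma flip_optimal K u w : optimal K u w -> optimal K (- u) (flip w).
Proof.
have areaE w' v : third_area (- v) (flip w') = third_area v w'.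
  by rewrite /third_area /cross /= !mxE; ring.
move=> [wK wmax]; split; first exact: flip_inscribed.
move=> w' /flip_inscribed; rewrite opprK => /wmax.
by rewrite -(areaE w' (- u)) opprK areaE.
Qed.

Definition mix (t : R) w w' : hexagon R :=
  ((1 - t) *: centre w + t *: centre w', (1 - t) *: rise w + t *: rise w',
   (1 - t) * skew w + t * skew w', (1 - t) * side w + t * side w').

Lemma mix_inscribed K u w w' t : convex_pts K -> 0 <= t <= 1 ->
  inscribed K u w -> inscribed K u w' -> inscribed K u (mix t w w').
Proof.
move=> cK t01 [h0 v0 wK] [h0' v0' wK']; split.
- by rewrite /= addr_ge0 // mulr_ge0//; lra.
- by rewrite /= crossD !crossZ addr_ge0 // mulr_ge0//; lra.
move=> i ic.
have -> : vertex u (mix t w w') i = (1 - t) *: vertex u w i + t *: vertex u w' i.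
  by rewrite /vertex /=; apply/rowP => j; rewrite !mxE; ring.
by apply: cK => //; [exact: wK|exact: wK'].
Qed.

(** Two pairs of nonnegative numbers with equal products y x = y' x' are ordered
    oppositely in their two coordinates, that is (y' - y) (x - x') >= 0; so
    the product at a mean of the pairs is at least the common value. *)
Lemma mix_optimal K u w w' t : convex_pts K -> 0 <= t <= 1 ->
  optimal K u w -> optimal K u w' -> optimal K u (mix t w w').
Proof.
move=> cK t01 [wK wm] [wK' wm']; split; first exact: mix_inscribed.
move=> w2 /wm w2m; apply: le_trans w2m _.
have eqa : third_area u w = third_area u w' by apply/eqP; rewrite eq_le wm// wm'.
case: wK => h0 v0 _; case: wK' => h0' v0' _.
move: eqa; rewrite /third_area /= crossD !crossZ => eqa.
move: (cross u (rise w)) (cross u (rise w')) (side w) (side w') v0 v0' h0 h0' eqa.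
move=> x x' y y' x0 x0' y0 y0' eqa.
have P : 0 <= (y' - y) * (x - x').
  have [xx'|xx'] := ltrP x x'; have [yy'|yy'] := ltrP y y'.
  - have : 0 <= y * (x' - x) by apply: mulr_ge0; lra.
    have : 0 < x' * (y' - y) by apply: mulr_gt0; lra.
    by lra.
  - by apply: mulr_le0; lra.
  - by apply: mulr_ge0; lra.
  - have : 0 <= x' * (y - y') by apply: mulr_ge0; lra.
    have : 0 <= y' * (x - x') by apply: mulr_ge0; lra.
    by lra.
have : 0 <= t * (1 - t) * ((y' - y) * (x - x')).
  by apply: mulr_ge0 => //; apply: mulr_ge0; lra.
move=> Q; set X := (X in _ <= X).
have -> : X = y * x + t * (1 - t) * ((y' - y) * (x - x')).
  by rewrite /X; ring: eqa.
lra.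
Qed.

Lemma segment_closed_cover (a b : R) (A B : set R) : closed A -> closed B ->
  `[a, b] `<=` A `|` B -> `[a, b] `&` A !=set0 -> `[a, b] `&` B !=set0 ->
  exists2 s, `[a, b]%classic s & A s /\ B s.
Proof.
move=> clA clB cover meetA [y [aby By]]; apply: contrapT => disj.
have nAB s : `[a, b]%classic s -> A s -> ~ B s by move=> abs As Bs; apply: disj; exists s.
have oB : exists2 C, open C & `[a, b]%classic `&` A = `[a, b]%classic `&` C.
  exists (~` B); first exact: closed_openC.
  apply/seteqP; split=> s [abs].
    by move=> As; split=> //; exact: nAB.
  by move=> nB; split=> //; case: (cover _ abs).
have cB : exists2 C, closed C & `[a, b]%classic `&` A = `[a, b]%classic `&` C.
  by exists A.
have abA := @segment_connected _ a b _ meetA oB cB.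
by apply: (nAB y) => //; move: aby; rewrite -abA => -[].
Qed.

(** The directions admitting an optimal hexagon of nonnegative skew form a
    closed set, and likewise for nonpositive skew.  The two sets cover the
    path of directions and each contains one of its ends, by [flip_optimal];
    over a common point a suitable mean of two optimal hexagons has skew 0. *)
Lemma balanced_exists K c : compact K -> convex_pts K -> K° c ->
  exists u w, [/\ u != 0, optimal K u w & skew w = 0].
Proof.
move=> kK cK Kc.
have clK : closed K by apply: compact_closed kK; exact: norm_hausdorff.
have [M boxM] := inscribed_box kK.
pose S (D : set R) := [set s | `[0, 1]%classic s /\
  exists w, optimal K (direction s) w /\ D (skew w)].
have clS D : closed D -> closed (S D).
  move=> clD; apply: compact_closed; first exact: Rhausdorff.
  have -> : S D = fst @` ((`[0, 1] `*` box M) `&`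
    ([set z | optimal K (direction z.1) z.2] `&` [set z | D (skew z.2)])).
    apply/seteqP; split=> s.
      move=> [s01 [w [wopt wD]]]; exists (s, w) => //; split=> //; split=> //.
      by apply: (boxM s); [move: s01; rewrite /= in_itv|case: wopt].
    by move=> [[s' w] [[/= s01 _] [wopt wD]] <-]; split=> //; exists w.
  apply: continuous_compact; first by apply: continuous_subspaceT => ?; exact: cvg_fst.
  apply: compact_closedI.
    by apply: compact_setX; [exact: segment_compact|exact: box_compact].
  have c1 : continuous (fun z : R * hexagon R => z.1).
    by apply: cont_fst => ?; exact: cvg_id.
  have c2 : continuous (fun z : R * hexagon R => z.2).
    by apply: cont_snd => ?; exact: cvg_id.
  have cd : continuous (fun z : R * hexagon R => (direction z.1, z.2)).
    by apply: cont_pair => //; exact: (cont_comp c1 direction_cont).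
  have cw : continuous (fun z : R * hexagon R => skew z.2).
    by apply: cont_snd; apply: cont_fst.
  apply: closedI; last by apply: preimage_closed clD => ? _; exact: cw.
  apply: (@preimage_closed _ _ (fun z => (direction z.1, z.2))
    [set z : V * hexagon R| optimal K z.1 z.2]); last exact: optimal_closed Kc.
  by move=> z _; exact: cd.
have memS s w D : 0 <= s <= 1 -> optimal K (direction s) w -> D (skew w) -> S D s.
  by move=> s01 wopt wD; split; [rewrite /= in_itv|exists w].
have s0 : 0 <= (0 : R) <= 1 by lra.
have s1 : 0 <= (1 : R) <= 1 by lra.
have [w0 w0opt] := optimal_exists kK cK Kc s0.
have w1opt : optimal K (direction 1) (flip w0) by rewrite direction1; exact: flip_optimal.
have [meet0 meet1] : `[0, 1] `&` S [set d | 0 <= d] !=set0 /\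
    `[0, 1] `&` S [set d | d <= 0] !=set0.
  have m D s w : 0 <= s <= 1 -> optimal K (direction s) w -> D (skew w) -> `[0, 1] `&` S D !=set0.
    by move=> *; exists s; split; [rewrite /= in_itv|exact: (memS s w)].
  have [d0|d0] := lerP 0 (skew w0); split.
  - exact: (m _ 0 w0).
  - by apply: (m _ 1 (flip w0)) => //=; lra.
  - by apply: (m _ 1 (flip w0)) => //=; lra.
  - by apply: (m _ 0 w0) => //=; lra.
have cover : `[0, 1]%classic `<=` S [set d | 0 <= d] `|` S [set d | d <= 0].
  move=> s; rewrite /= in_itv /= => s01.
  have [w wopt] := optimal_exists kK cK Kc s01.
  have [d0|d0] := lerP 0 (skew w); [left|right]; apply: (memS s w) => //=.
  exact: ltW.
have [s s01 [[_ [w [wopt dw]]] [_ [w' [w'opt dw']]]]] := segment_closed_cover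
  (clS _ (@closed_ge _ 0)) (clS _ (@closed_le _ 0)) cover meet0 meet1.
rewrite /= in_itv /= in s01; rewrite /= in dw dw'.
exists (direction s); have [dd|dd] := eqVneq (skew w) (skew w').
  by exists w; split=> //; [exact: direction_neq0|lra].
have {}dd : 0 < skew w - skew w' by rewrite lt_def subr_eq0 dd /=; lra.
exists (mix (skew w / (skew w - skew w')) w w'); split; first exact: direction_neq0.
- apply: mix_optimal => //.
  by rewrite divr_ge0 ?ler_pdivrMr// ?mul1r; lra.
- by rewrite /=; field; lra.
Qed.

End BalancedHexagon.

(** * Covering in hexagonal coordinates *)

Section Coordinates.
Variable R : realType.
Implicit Types (S : R -> R -> Prop) (a b : R).

(** [S a b] stands for membership in [K] of the point with coordinates (a, b)
    relative to the centre and to two adjacent vertices of an affine regular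
    hexagon; the six points are its vertices in cyclic order. *)
Record hexagonal S : Prop := Hexagonal {
  hex_conv : forall a b a' b' t, S a b -> S a' b' -> 0 <= t <= 1 ->
    S ((1 - t) * a + t * a') ((1 - t) * b + t * b');
  hex_p1 : S 1 0; hex_p2 : S 0 1; hex_p3 : S (-1) 1;
  hex_p4 : S (-1) 0; hex_p5 : S 0 (-1); hex_p6 : S 1 (-1) }.

(** What optimality says about horizontal chords; together with [hexagonal] it
    confines [S] to the star of the hexagon. *)
Definition tight S := (forall a b, S a b -> S (a + 1) b -> -1 <= b <= 1) /\
  (forall a l, S a 0 -> S (a + l) 0 -> l <= 2).

(** Symmetries of the hexagon: [rot] sends each vertex to the next one,
    [mirror] exchanges left and right and keeps horizontal lines. *)
Definition rot S a b := S (- b) (a + b).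
Definition mirror S a b := S (- a - b) b.
Definition neg S a b := S (- a) (- b).

(** Membership transported along equations that [ring] or [lra] proves. *)
Lemma rel_eq S a b a' b' : S a b -> a = a' -> b = b' -> S a' b'.
Proof. by move=> Sab <- <-. Qed.

Lemma hexagonal_rot S : hexagonal S -> hexagonal (rot S).
Proof.
case=> cS *; split; rewrite /rot ?(oppr0, opprK, addr0, add0r, subrr, addrK) //.
- by move=> a b a' b' t Sab Sab' t01; apply: rel_eq (cS _ _ _ _ t Sab Sab' t01) _ _; ring.
all: by rewrite ?addNr.
Qed.

Lemma hexagonal_mirror S : hexagonal S -> hexagonal (mirror S).
Proof.
case=> cS *; split; rewrite /mirror ?(oppr0, opprK, subr0, add0r, subrr, addrK, sub0r) //.
by move=> a b a' b' t Sab Sab' t01; apply: rel_eq (cS _ _ _ _ t Sab Sab' t01) _ _; ring.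
Qed.

Lemma hexagonal_neg S : hexagonal S -> hexagonal (neg S).
Proof.
case=> cS *; split; rewrite /neg ?(oppr0, opprK) //.
by move=> a b a' b' t Sab Sab' t01; apply: rel_eq (cS _ _ _ _ t Sab Sab' t01) _ _; ring.
Qed.

Lemma tight_mirror S : tight S -> tight (mirror S).
Proof.
case=> Sb Sl; split=> [a b|a l]; rewrite /mirror => S1 S2.
- by apply: (Sb (- (a + 1) - b) b) => //; apply: rel_eq S1 _ _ => //; ring.
- by apply: (Sl (- (a + l) - 0) l) => //; apply: rel_eq S1 _ _ => //; ring.
Qed.

Lemma tight_neg S : tight S -> tight (neg S).
Proof.
case=> Sb Sl; split=> [a b|a l]; rewrite /neg ?oppr0 => S1 S2.
- have : -1 <= - b <= 1.
    by apply: (Sb (- (a + 1)) (- b)) => //; apply: rel_eq S1 _ _ => //; ring.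
  lra.
- by apply: (Sl (- (a + l)) l) => //; apply: rel_eq S1 _ _ => //; ring.
Qed.

(** A point with a > 1 would, with the vertex (1, -1), lengthen the chord
    through the centre.  A point with b > 1 would, with (1, 0), lengthen the
    top side; the hull of the longer chord and of the point contains a
    chord of length 1 above that side. *)
Lemma right_star S a b : hexagonal S -> tight S -> S a b -> 0 <= a -> 0 <= b ->
  a <= 1 /\ b <= 1.
Proof.
move=> hS [Sb Sl] Sab a0 b0; split; rewrite leNgt; apply/negP.
- move=> a1; pose t := (1 + b)^-1.
  have b1 : 1 + b != 0 by lra.
  have tb : t * (1 + b) = 1 by rewrite /t mulVf.
  have t0 : 0 < t by rewrite /t invr_gt0; lra.
  have t1 : 0 <= t <= 1 by rewrite ltW//= /t invf_le1; lra.
  have SY : S ((1 - t) * 1 + t * a) 0.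
    by apply: rel_eq (hex_conv hS (hex_p6 hS) Sab t1) _ _ => //; nra.
  have : (1 - t) * 1 + t * a + 1 <= 2.
    by apply: (Sl (-1)); [exact: hex_p4|apply: rel_eq SY _ _ => //; ring].
  by nra.
- move=> b1; pose t := b^-1.
  have tb : t * b = 1 by rewrite /t mulVf; lra.
  have t0 : 0 < t by rewrite /t invr_gt0; lra.
  have t1 : t < 1 by rewrite /t invf_lt1; lra.
  have t01 : 0 <= t <= 1 by lra.
  set y := (1 - t) * 1 + t * a.
  have y0 : 0 < y by rewrite /y; nra.
  have SY : S y 1.
    by apply: rel_eq (hex_conv hS (hex_p1 hS) Sab t01) _ _ => //; nra.
  have SX := hex_conv hS (hex_p3 hS) Sab.
  have SX' := hex_conv hS SY Sab.
  (* at the fraction s of the way to (a, b), the chord from (-1, 1) to (y, 1)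
     has shrunk to length 1 *)
  pose s := y / (1 + y).
  have s01 : 0 <= s <= 1 by rewrite /s divr_ge0 ?ler_pdivrMr/= ?mul1r; lra.
  have s0 : 0 < s by rewrite /s divr_gt0; lra.
  have sy : s * (1 + y) = y by rewrite /s divfK; lra.
  have : -1 <= (1 - s) * 1 + s * b <= 1.
    apply: (Sb ((1 - s) * -1 + s * a)); first exact: SX.
    by apply: rel_eq (SX' _ s01) _ _ => //; nra.
  by nra.
Qed.

(** Same argument with the vertex (-1, 0): the chord at height 1 becomes longer
    than the top side, whose right end (0, 1) it keeps. *)
Lemma top_star_left S a b : hexagonal S -> tight S -> rot S a b -> 0 <= a -> 0 <= b ->
  b <= 1.
Proof.
rewrite /rot => hS [Sb Sl] Sab a0 b0; rewrite leNgt; apply/negP => b1.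
pose t := (a + b)^-1.
have tb : t * (a + b) = 1 by rewrite /t mulVf; lra.
have t0 : 0 < t by rewrite /t invr_gt0; lra.
have t1 : t < 1 by rewrite /t invf_lt1; lra.
have t01 : 0 <= t <= 1 by lra.
set z := (1 - t) * -1 + t * - b.
have z1 : z < -1 by rewrite /z; nra.
have SY : S z 1.
  by apply: rel_eq (hex_conv hS (hex_p4 hS) Sab t01) _ _ => //; nra.
have SX := hex_conv hS SY Sab.
have SX' := hex_conv hS (hex_p2 hS) Sab.
pose s := (z + 1) / z.
have s01 : 0 < s <= 1.
  by rewrite /s -[_ / _]mulrNN -invrN divr_gt0 ?ler_pdivrMr ?mul1r; lra.
have sz : s * z = z + 1 by rewrite /s divfK; lra.
have s01' : 0 <= s <= 1 by lra.
have : -1 <= (1 - s) * 1 + s * (a + b) <= 1.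
  apply: (Sb ((1 - s) * z + s * - b)); first exact: SX.
  by apply: rel_eq (SX' _ s01') _ _ => //; nra.
by nra.
Qed.

Lemma top_star S a b : hexagonal S -> tight S -> rot S a b -> 0 <= a -> 0 <= b ->
  a <= 1 /\ b <= 1.
Proof.
move=> hS tS Sab a0 b0; split; last exact: (top_star_left hS tS Sab).
apply: (@top_star_left (mirror S) b a) => //.
- exact: hexagonal_mirror.
- exact: tight_mirror.
- by rewrite /rot /mirror; apply: (@rel_eq S) Sab _ _; ring.
Qed.

Lemma triangle_sub S a b : hexagonal S -> 0 <= a -> 0 <= b -> a + b <= 1 -> S a b.
Proof.
move=> hS a0 b0 ab1.
have S0 : S 0 0.
  have h : 0 <= (1 / 2 : R) <= 1 by lra.
  by apply: rel_eq (hex_conv hS (hex_p1 hS) (hex_p4 hS) h) _ _; lra.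
have [ab|ab] := eqVneq (a + b) 0; first by apply: rel_eq S0 _ _; lra.
have ab0 : 0 < a + b by rewrite lt_def ab /=; lra.
pose t := b / (a + b).
have t01 : 0 <= t <= 1 by rewrite /t divr_ge0 ?ler_pdivrMr ?mul1r; lra.
have ab01 : 0 <= a + b <= 1 by lra.
have := hex_conv hS S0 (hex_conv hS (hex_p1 hS) (hex_p2 hS) t01) ab01.
by move/rel_eq; apply; rewrite /t; field.
Qed.

Lemma hexagon_sub S a b : hexagonal S -> -1 <= a <= 1 -> -1 <= b <= 1 ->
  -1 <= a + b <= 1 -> S a b.
Proof.
wlog b0 : S a b / 0 <= b.
  move=> up hS a1 b1 ab1; have [b0|b0] := lerP 0 b; first exact: up.
  have := up (neg S) (- a) (- b) _ (hexagonal_neg hS); rewrite /neg !opprK.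
  by apply; lra.
move=> hS a1 b1 ab1; have hS1 := hexagonal_rot hS.
have [a0|a0] := lerP 0 a; first by apply: triangle_sub => //; lra.
have [ab0|ab0] := lerP 0 (a + b).
  have : rot S (a + b) (- a) by apply: triangle_sub => //; lra.
  by move/(@rel_eq S); apply; ring.
have : rot (rot S) b (- a - b) by apply: (triangle_sub (hexagonal_rot hS1)); lra.
by move/(@rel_eq S); apply; ring.
Qed.

(** In the sector between the vertices (1, 0) and (0, 1) the centre copy of
    K/2 covers the points with a + b <= 1/2.  The copy at the midpoint of the
    side covers the others: when (2 a - 1, 2 b - 1) is not in the hexagon, it
    lies between (a, b) and the point where the line from (1, 1) through
    (a, b) meets the side. *)
Lemma sector_cover S a b : hexagonal S -> S a b -> 0 <= a <= 1 -> 0 <= b <= 1 ->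
  S (2 * a) (2 * b) \/ S (2 * a - 1) (2 * b - 1).
Proof.
move=> hS Sab a01 b01.
have [ab|ab] := lerP (a + b) (1 / 2).
  by left; apply: triangle_sub => //; lra.
right; have [ab'|ab'] := lerP (a + b) (3 / 2).
  by apply: hexagon_sub => //; lra.
have [ab2|ab2] := eqVneq (a + b) 2; first by apply: rel_eq Sab _ _; lra.
have {}ab2 : 0 < 2 - a - b by rewrite lt_def; apply/andP; split; [lra|lra].
have Sz : S ((1 - b) / (2 - a - b)) ((1 - a) / (2 - a - b)).
  apply: triangle_sub => //; rewrite ?divr_ge0//; try lra.
  by rewrite -mulrDl ler_pdivrMr; lra.
pose s := (2 - a - b) / (a + b - 1).
have s01 : 0 <= s <= 1 by rewrite /s divr_ge0 ?ler_pdivrMr ?mul1r; lra.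
have := hex_conv hS Sab Sz s01.
by move/rel_eq; apply; rewrite /s; field; lra.
Qed.

(** The three sectors above the horizontal diagonal; each shift is the sum of
    the two vertices of the sector. *)
Lemma upper_cover S a b : hexagonal S -> tight S -> S a b -> 0 <= b ->
  [\/ S (2 * a) (2 * b), S (2 * a - 1) (2 * b - 1),
      S (2 * a + 1) (2 * b - 2) | S (2 * a + 2) (2 * b - 1)].
Proof.
move=> hS tS Sab b0.
have hS1 := hexagonal_rot hS; have hS2 := hexagonal_rot hS1.
have [a0|a0] := lerP 0 a.
  have [a1 b1] := right_star hS tS Sab a0 b0.
  have [|||] := sector_cover hS Sab; [lra|lra|by constructor 1|by constructor 2].
have [ab0|ab0] := lerP 0 (a + b).
  have S1ab : rot S (a + b) (- a) by apply: (@rel_eq S) Sab _ _; ring.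
  have [||a1 b1] := top_star hS tS S1ab; [lra|lra|].
  have [||SS|SS] := sector_cover hS1 S1ab; [lra|lra|constructor 1|constructor 3];
    by apply: (@rel_eq S) SS _ _; ring.
have S2ab : rot (rot S) b (- a - b) by apply: (@rel_eq S) Sab _ _; ring.
have S2ab' : mirror S (- a - b) b by apply: (@rel_eq S) Sab _ _; ring.
have [||a1 b1] := right_star (hexagonal_mirror hS) (tight_mirror tS) S2ab'; [lra|lra|].
have [||SS|SS] := sector_cover hS2 S2ab; [lra|lra|constructor 1|constructor 4];
    by apply: (@rel_eq S) SS _ _; ring.
Qed.

End Coordinates.

(** * Chords of the body and optimality *)

Section Chords.
Variable R : realType.
Notation V := 'rV[R]_2.
Implicit Types (K : set V) (x y u : V) (w : hexagon R).

Lemma mem_eq (T : Type) (A : set T) (x y : T) : A x -> x = y -> A y.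
Proof. by move=> Ax <-. Qed.

Definition chord K u c (r : R) := K (c + r *: u) /\ K (c + (- r) *: u).

Lemma chord_mix K u c c' r r' t : convex_pts K -> 0 <= t <= 1 ->
  chord K u c r -> chord K u c' r' ->
  chord K u ((1 - t) *: c + t *: c') ((1 - t) * r + t * r').
Proof.
move=> cK t01 [c1 c2] [c3 c4]; split.
  apply: mem_eq (cK _ _ t c1 c3 t01) _.
  by apply/rowP => j; rewrite !mxE; ring.
apply: mem_eq (cK _ _ t c2 c4 t01) _.
by apply/rowP => j; rewrite !mxE; ring.
Qed.

Lemma chord_trunc K u c r r' : convex_pts K -> 0 <= r' <= r ->
  chord K u c r -> chord K u c r'.
Proof.
move=> cK /andP[r0 rr]; have [r00|r00] := eqVneq r 0.
  by have -> : r' = r by lra.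
case=> c1 c2.
have t01 : 0 <= (r - r') / (2 * r) <= 1.
  by rewrite divr_ge0 ?ler_pdivrMr ?mul1r; lra.
split.
  apply: mem_eq (cK _ _ _ c1 c2 t01) _.
  by apply/rowP => j; rewrite !mxE; field.
apply: mem_eq (cK _ _ _ c2 c1 t01) _.
by apply/rowP => j; rewrite !mxE; field.
Qed.

Lemma cross0_colinear u x : u != 0 -> cross u x = 0 -> exists d, x = d *: u.
Proof.
move=> u0 ux.
have [u00|u00] := eqVneq (u 0 0) 0.
  have u1 : u 0 1 != 0.
    apply: contra u0 => /eqP u01; apply/eqP/rowP => j; rewrite mxE.
    by case: (ord2 j) => ->.
  exists (x 0 1 / u 0 1); apply/rowP => j; rewrite mxE; case: (ord2 j) => ->.
    rewrite u00 mulr0; apply/eqP; move/eqP: ux; rewrite /cross u00 mul0r sub0r.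
    by rewrite oppr_eq0 mulf_eq0 (negbTE u1).
  by rewrite divfK.
exists (x 0 0 / u 0 0); apply/rowP => j; rewrite mxE; case: (ord2 j) => ->.
  by rewrite divfK.
rewrite mulrAC; apply/(canRL (mulfK u00)).
by apply/eqP; rewrite -subr_eq0 -ux /cross; apply/eqP; ring.
Qed.

(** Three parallel chords, the third halfway between the others, form an
    inscribed hexagon once their lengths are h, h and 2 h: the only freedom
    left is the skew. *)
Lemma optimal_chords K u w ct cb cm h : optimal K u w -> u != 0 -> 0 <= h ->
  chord K u ct (1 / 2 * h) -> chord K u cb (1 / 2 * h) -> chord K u cm h ->
  cross u cb <= cross u ct -> cross u ct + cross u cb = 2 * cross u cm ->
  h * ((cross u ct - cross u cb) / 2) <= third_area u w.
Proof.
move=> [_ wmax] u0 h0 [t1 t2] [b1 b2] [m1 m2] bt tbm.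
have [|d dE] := @cross0_colinear u (cm - (1 / 2) *: (ct + cb)) u0.
  by rewrite crossD crossN crossZ crossD; lra.
pose w' : hexagon R := ((1 / 2) *: (ct + cb), (1 / 2) *: (ct - cb), d, h).
have areaE : third_area u w' = h * ((cross u ct - cross u cb) / 2).
  by rewrite /third_area /= crossZ crossD crossN; field.
rewrite -areaE; apply: wmax; split => //=.
  by rewrite crossZ crossD crossN; lra.
have dj j : cm 0 j - (1 / 2) * (ct 0 j + cb 0 j) = d * u 0 j.
  by have := congr1 (fun x : V => x 0 j) dE; rewrite !mxE.
apply/vertex_codesP; rewrite /vertex /=; split; split;
  [apply: mem_eq t1 _|apply: mem_eq t2 _|apply: mem_eq b1 _
  |apply: mem_eq b2 _|apply: mem_eq m1 _|apply: mem_eq m2 _];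
  apply/rowP => j; move: (dj j); rewrite !mxE; lra.
Qed.

(** A chord of length h at height 2 s above the top side replaces this side.
    The middle rises by s, where the hull of the diagonal and of the new chord
    leaves length h (2 - n) with n = s / (W + 2 s).  The height W grows to
    W + s, and (1 - n/2) (W + s) > W. *)
Lemma optimal_no_higher_chord K c0 u w c : convex_pts K -> K° c0 -> u != 0 ->
  optimal K u w -> chord K u c (1 / 2 * side w) ->
  cross u c <= cross u (centre w + rise w).
Proof.
move=> cK Kc0 u0 wopt hc; rewrite leNgt; apply/negP => higher.
have := optimal_third_area_gt0 Kc0 u0 wopt; move: wopt hc higher.
case: w => [[[g v] d] h] wopt /= hc higher area0.
have [h0 W0] := third_area_gt0 wopt.1 area0.
have [[_ _ /vertex_codesP[[t1 t2] [b1 b2] [m1 m2]]] _] := wopt.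
rewrite /vertex /= in t1 t2 b1 b2 m1 m2.
rewrite /= in h0 W0; set W := cross u v in W0.
pose s := (cross u c - cross u g - W) / 2.
have s0 : 0 < s by move: higher; rewrite /s /W crossD; lra.
pose n := s / (W + 2 * s).
have nW : n * (W + 2 * s) = s by rewrite /n divfK; lra.
have n0 : 0 < n by rewrite divr_gt0; lra.
have n1 : n < 1 by rewrite ltr_pdivrMr; lra.
have n01 : 0 <= n <= 1 by lra.
pose h' := (1 - n) * h + n * (1 / 2 * h).
have h'0 : 0 <= h' <= h by rewrite /h'; nra.
have mid : chord K u (g + d *: u) h.
  by split; [apply: mem_eq m1 _|apply: mem_eq m2 _]; apply/rowP => j; rewrite !mxE; ring.
have bot : chord K u (g - v) (1 / 2 * h).
  by split; [apply: mem_eq b1 _|apply: mem_eq b2 _]; apply/rowP => j; rewrite !mxE; ring.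
have mid' := chord_mix cK n01 mid hc.
have top' : chord K u c (1 / 2 * h') by apply: chord_trunc hc => //; lra.
have bot' : chord K u (g - v) (1 / 2 * h') by apply: chord_trunc bot => //; lra.
have ineq : h' * ((cross u c - cross u (g - v)) / 2) <= h * W.
  apply: (optimal_chords wopt u0 _ top' bot' mid'); first lra.
    by rewrite crossD crossN -/W; move: s0; rewrite /s; lra.
  rewrite !(crossD, crossZ, crossN) crossuu -/W.
  have -> : cross u c = cross u g + W + 2 * s by rewrite /s; field.
  by move: nW; lra.
move: ineq; rewrite crossD crossN -/W.
have -> : cross u c = cross u g + W + 2 * s by rewrite /s; field.
rewrite /h' => ineq.
have : 0 < h * (s - n / 2 * (W + s)).
  apply: mulr_gt0 => //.
  have : n * (W + s) < n * (W + 2 * s) by rewrite ltr_pM2l//; lra.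
  lra.
lra.
Qed.

Lemma optimal_no_lower_chord K c0 u w c : convex_pts K -> K° c0 -> u != 0 ->
  optimal K u w -> chord K u c (1 / 2 * side w) ->
  cross u (centre w - rise w) <= cross u c.
Proof.
move=> cK Kc0 u0 wopt [c1 c2].
have : cross (- u) c <= cross (- u) (centre w - rise w).
  apply: (optimal_no_higher_chord cK Kc0 _ (flip_optimal wopt)).
    by rewrite oppr_eq0.
  by split => /=; rewrite scalerN -scaleNr ?opprK.
by rewrite /cross !mxE; lra.
Qed.

(** A chord of half-length r > h at the height of the centre replaces the
    diagonal.  In its hull with the top and bottom sides there are chords of
    length r at the fraction 1 - n = r / (2 r - h) of the height W, so the
    product becomes r W r / (2 r - h), and r^2 > h (2 r - h). *)
Lemma optimal_no_longer_chord K c0 u w c r : convex_pts K -> K° c0 -> u != 0 ->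
  optimal K u w -> chord K u c r -> cross u c = cross u (centre w) -> r <= side w.
Proof.
move=> cK Kc0 u0 wopt hc cE; rewrite leNgt; apply/negP => longer.
have := optimal_third_area_gt0 Kc0 u0 wopt; move: wopt hc longer cE.
case: w => [[[g v] d] h] wopt /= hc longer cE area0.
have [h0 W0] := third_area_gt0 wopt.1 area0.
have [[_ _ /vertex_codesP[[t1 t2] [b1 b2] _]] _] := wopt.
rewrite /vertex /= in t1 t2 b1 b2.
rewrite /= in h0 W0; set W := cross u v in W0.
pose n := (r - h) / (2 * r - h).
have nr : n * (2 * r - h) = r - h by rewrite /n divfK; lra.
have n01 : 0 <= n <= 1 by rewrite /n divr_ge0 ?ler_pdivrMr ?mul1r; lra.
have top : chord K u (g + v) (1 / 2 * h).
  by split; [apply: mem_eq t1 _|apply: mem_eq t2 _]; apply/rowP => j; rewrite !mxE; ring.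
have bot : chord K u (g - v) (1 / 2 * h).
  by split; [apply: mem_eq b1 _|apply: mem_eq b2 _]; apply/rowP => j; rewrite !mxE; ring.
have half : (1 - n) * (1 / 2 * h) + n * r = 1 / 2 * r by lra.
have top' := chord_mix cK n01 top hc; have bot' := chord_mix cK n01 bot hc.
rewrite half in top' bot'.
have W1 : 0 <= (1 - n) * W by apply: mulr_ge0; lra.
have {}ineq : r * ((1 - n) * W) <= h * W.
  apply: le_trans (optimal_chords wopt u0 _ top' bot' hc _ _); try lra;
    rewrite !(crossD, crossZ, crossN) -/W cE; lra.
have {}ineq : r * (1 - n) <= h by rewrite -(ler_pM2r W0) -mulrA.
have : n * (2 * r - h) * r = (r - h) * r by rewrite nr.
have : r * (1 - n) * (2 * r - h) <= h * (2 * r - h) by rewrite ler_pM2r//; lra.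
have : 0 < (r - h) * (r - h) by apply: mulr_gt0; lra.
lra.
Qed.

End Chords.

(** * Levi's theorem *)

Section Levi.
Variable R : realType.
Notation V := 'rV[R]_2.
Implicit Types (K : set V) (x y u : V) (w : hexagon R).

Lemma tight_hexagon_exists K : planar_convex_body K -> exists g p q : V,
  [/\ cross p q != 0, hexagonal (fun a b => K (g + a *: p + b *: q)) &
      tight (fun a b => K (g + a *: p + b *: q))].
Proof.
move=> [kK /convex_set_pts cK [c0 Kc0]].
have [u [w [u0 wopt d0]]] := balanced_exists kK cK Kc0.
have area0 := optimal_third_area_gt0 Kc0 u0 wopt.
have higher := optimal_no_higher_chord cK Kc0 u0 wopt.
have lower := optimal_no_lower_chord cK Kc0 u0 wopt.
have longer := optimal_no_longer_chord cK Kc0 u0 wopt.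
move: wopt d0 area0 higher lower longer.
case: w => [[[g v] d] h] /= wopt d0.
rewrite d0 {d d0} in wopt * => area0 higher lower longer.
have [h0 W0] := third_area_gt0 wopt.1 area0.
have [[_ _ /vertex_codesP[[t1 t2] [b1 b2] [m1 m2]]] _] := wopt.
rewrite /vertex /= in t1 t2 b1 b2 m1 m2.
rewrite /= in h0 W0; set W := cross u v in W0.
pose p := h *: u; pose q := v + (1 / 2 * h) *: u.
have crossuq : cross u q = W by rewrite /q crossD crossZ crossuu mulr0 addr0.
have crossup : cross u p = 0 by rewrite /p crossZ crossuu mulr0.
exists g, p, q; split.
- have -> : cross p q = h * W by rewrite -crossuq /cross !mxE; ring.
  by rewrite mulf_neq0 ?gt_eqF.
- split.
  + move=> a b a' b' t K1 K2 t01; apply: mem_eq (cK _ _ t K1 K2 t01) _.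
    by apply/rowP => j; rewrite !mxE; ring.
  + by apply: mem_eq m1 _; apply/rowP => j; rewrite !mxE; field.
  + by apply: mem_eq t1 _; apply/rowP => j; rewrite !mxE; field.
  + by apply: mem_eq t2 _; apply/rowP => j; rewrite !mxE; field.
  + by apply: mem_eq m2 _; apply/rowP => j; rewrite !mxE; field.
  + by apply: mem_eq b2 _; apply/rowP => j; rewrite !mxE; field.
  + by apply: mem_eq b1 _; apply/rowP => j; rewrite !mxE; field.
- have crossE (a b : R) : cross u (g + a *: p + b *: q) = cross u g + b * W.
    by rewrite crossD [cross u (g + _)]crossD (crossZ u a p) (crossZ u b q) crossuq crossup; ring.
  split=> [a b|a l] K1 K2.
    have ch : chord K u (g + (a + 1 / 2) *: p + b *: q) (1 / 2 * h).
      split; [apply: mem_eq K2 _|apply: mem_eq K1 _];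
        by apply/rowP => j; rewrite !mxE; field.
    have := higher _ ch; have := lower _ ch; rewrite crossE !crossD crossN -/W.
    by move=> lo hi; apply/andP; split; rewrite -(ler_pM2r W0); lra.
  have ch : chord K u (g + (a + l / 2) *: p + 0 *: q) (l / 2 * h).
    split; [apply: mem_eq K2 _|apply: mem_eq K1 _];
      by apply/rowP => j; rewrite !mxE; field.
  have := longer _ _ ch; rewrite crossE mul0r addr0 => /(_ erefl) lh.
  have : l / 2 <= 1 by rewrite -(ler_pM2r h0) mul1r.
  lra.
Qed.

(** Levi's theorem: seven half-size copies, one at the centre and one at the
    midpoint of each side of a tight hexagon. *)
Lemma levi_cover K : planar_convex_body K -> exists t : 'I_7 -> V,
  K `<=` \bigcup_(i in [set: 'I_7]) homothet K (1 / 2) (t i).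
Proof.
move=> bK; have [g [p [q [pq0 hS tS]]]] := tight_hexagon_exists bK.
set S := (fun a b : R => K _) in hS tS.
pose c : seq (R * R) :=
  (* the origin and the sums of two adjacent vertices *)
  [:: (0, 0); (1, 1); (-1, 2); (-2, 1); (-1, -1); (1, -2); (2, -1)].
exists (fun i => (1 / 2) *: (g + (nth (0, 0) c i).1 *: p + (nth (0, 0) c i).2 *: q)).
move=> x Kx.
have [a [b xE]] : exists a b, x = g + a *: p + b *: q.
  exists (cross (x - g) q / cross p q), (cross p (x - g) / cross p q).
  apply/rowP => j; rewrite !mxE /cross !mxE.
  rewrite /cross in pq0; case: (ord2 j) => ->; field => //.
have Sab : S a b by rewrite /S -xE.
have pick i : (i < 7)%N -> S (2 * a - (nth (0, 0) c i).1) (2 * b - (nth (0, 0) c i).2) ->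
    (\bigcup_(i in [set: 'I_7]) homothet K (1 / 2)
      ((1 / 2) *: (g + (nth (0, 0) c i).1 *: p + (nth (0, 0) c i).2 *: q))) x.
  move=> i7 Si; exists (Ordinal i7) => //; move: Si => /=.
  move: (nth _ _ _) => [e f] /= Si.
  exists (g + (2 * a - e) *: p + (2 * b - f) *: q); first exact: Si.
  by rewrite xE; apply/rowP => j; rewrite !mxE; field.
have [b0|b0] := lerP 0 b.
  have [SS|SS|SS|SS] := upper_cover hS tS Sab b0;
    [apply: (pick 0)|apply: (pick 1)|apply: (pick 2)|apply: (pick 3)] => //;
    apply: rel_eq SS _ _ => /=; ring.
have Sab' : neg S (- a) (- b) by rewrite /neg !opprK.
have b0' : 0 <= - b by lra.
have [SS|SS|SS|SS] := upper_cover (hexagonal_neg hS) (tight_neg tS) Sab' b0';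
    [apply: (pick 0)|apply: (pick 4)|apply: (pick 5)|apply: (pick 6)] => //;
    apply: (@rel_eq _ S) SS _ _ => /=; ring.
Qed.

Lemma gamma_le K m l : 0 < l -> (exists t : 'I_m -> V,
  K `<=` \bigcup_(i in [set: 'I_m]) homothet K l (t i)) -> gamma m K <= l.
Proof.
move=> l0 cov; apply: inf_lbound; last by split.
by exists 0 => y [/ltW].
Qed.

Lemma coin_le14 K : planar_convex_body K -> (coin K <= 14%:E)%E.
Proof.
move=> /levi_cover cov.
have g7 : gamma 7 K <= 1 / 2 by apply: gamma_le cov; lra.
apply: (@le_trans _ _ (7%:R / (1 - gamma 7 K))%:E).
  by apply: ereal_inf_lbound; exists 7%N.
by rewrite lee_fin ler_pdivrMr; lra.
Qed.

End Levi.

(** * Sines of polygon angles *)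

Section Trigo.
Variable R : realType.
Implicit Types x y : R.

(** From sin (3 x) = 3 s - 4 s^3 at x = pi / 6 one gets
    (s + 1) (2 s - 1)^2 = 0. *)
Lemma sin_pi6 : sin (pi / 6) = 1 / 2 :> R.
Proof.
have pi0 := @pi_gt0 R.
have s0 : 0 < sin (pi / 6) :> R by apply: sin_gt0_pihalf; lra.
have : sin (pi / 6 + (pi / 6 + pi / 6)) = 1 :> R.
  by rewrite -[RHS]sin_pihalf; congr sin; field.
rewrite sinD cosD sinD; move: (cos2Dsin2 (pi / 6 : R)) s0.
set s := sin _; set c := cos _ => cs s0 e.
have : (s + 1) * (2 * s - 1) ^+ 2 = 0.
  have c2 : c ^+ 2 = 1 - s ^+ 2 by lra.
  have -> : (s + 1) * (2 * s - 1) ^+ 2 =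
      1 - (s * (c * c - s * s) + c * (s * c + c * s)) by ring: c2.
  by rewrite e subrr.
move/eqP; rewrite mulf_eq0 sqrf_eq0 => /orP[] /eqP; lra.
Qed.

Lemma sin_mono x y : - (pi / 2) <= x -> y <= pi / 2 -> x <= y -> sin x <= sin y.
Proof.
move=> x0 y1; rewrite le_eqVlt => /predU1P[->//|xy]; rewrite ltW//.
by rewrite ltr_sin// in_itv /=; lra.
Qed.

(** Concavity of the sine: the mean slope on [0, x] is a value of the cosine
    to the left of one that gives the mean slope on [x, pi / 6]. *)
Lemma sin_ge_chord x : 0 <= x <= pi / 6 -> 3 / pi * x <= sin x.
Proof.
have pi0 := @pi_gt0 R => /andP[x0 x1].
have dsin y : is_derive y 1 (@sin R) (cos y) by exact: is_derive_sin.
have csin (A : set R) : {within A, continuous (@sin R)}.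
  by apply: continuous_subspaceT => z; exact: continuous_sin.
have [||c1 c1x] := @MVT_segment R sin cos 0 x; [by []|exact: csin|].
have [||c2 c2x] := @MVT_segment R sin cos x (pi / 6); [by []|exact: csin|].
rewrite sin_pi6 sin0 !subr0 => e2 e1.
have cc : cos c2 <= cos c1.
  move: c1x c2x; rewrite !in_itv /= => c1x c2x.
  have [->//|ne] := eqVneq c1 c2; have lt12 : c1 < c2 by rewrite lt_neqAle ne; lra.
  by rewrite ltW// ltr_cos// in_itv /=; lra.
have : (1 / 2 - sin x) * x <= sin x * (pi / 6 - x).
  have -> : (1 / 2 - sin x) * x = cos c2 * ((pi / 6 - x) * x) by rewrite e2; ring.
  have -> : sin x * (pi / 6 - x) = cos c1 * ((pi / 6 - x) * x) by rewrite e1; ring.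
  by apply: ler_wpM2r => //; apply: mulr_ge0; lra.
move=> h; rewrite mulrAC ler_pdivrMr//; lra.
Qed.

(** The sides of a regular polygon are its shortest chords. *)
Lemma sin_polygon_min n d : (1 < n)%N -> (0 < d < n)%N ->
  sin (pi / n%:R) <= sin (d%:R * (pi / n%:R)) :> R.
Proof.
move=> n1 /andP[d0 dn]; have pi0 := @pi_gt0 R.
set x : R := pi / n%:R.
have nx : n%:R * x = pi by rewrite /x mulrC divfK// pnatr_eq0; case: n n1 {d0 dn x}.
have x0 : 0 < x by rewrite divr_gt0// ltr0n (ltn_trans _ n1).
wlog half : d d0 dn / d%:R * x <= pi / 2.
  move=> le; have [h|h] := lerP (d%:R * x) (pi / 2); first exact: le.
  have -> : sin (d%:R * x) = sin ((n - d)%:R * x).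
    rewrite natrB 1?ltnW// mulrBl nx sinB sinpi cospi; ring.
  apply: le; first by rewrite subn_gt0.
    by rewrite ltn_subrL d0 (ltn_trans _ n1).
  by rewrite natrB 1?ltnW// mulrBl nx; lra.
apply: sin_mono => //; first lra.
by rewrite ler_peMl ?(ltW x0)// ler1n.
Qed.

Lemma cos_le_away x y : 0 <= y <= pi -> y <= x <= 2 * pi - y -> cos x <= cos y.
Proof.
move=> y0 xy; have pi0 := @pi_gt0 R.
have mono z t : 0 <= z -> t <= pi -> z <= t -> cos t <= cos z.
  move=> z0 t1; rewrite le_eqVlt => /predU1P[->//|zt]; rewrite ltW//.
  by rewrite ltr_cos ?in_itv /=; lra.
have [xpi|xpi] := lerP x pi; first by apply: mono; lra.
have -> : cos x = cos (2 * pi - x).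
  have -> : 2 * pi - x = pi + (pi - x) by ring.
  by rewrite cosD cosB sinpi cospi; ring.
by apply: mono; lra.
Qed.

End Trigo.

(** * Rotating polygons on the unit circle *)

Section Polygon.
Variables (R : realType).

(** The disk with centre (a, b) and radius l contains the point of the unit
    circle at angle psi from the unit vector (e1, e2).  Working relative to a
    unit vector avoids the polar angle of a point. *)
Definition covers_angle (e1 e2 a b l psi : R) :=
  (cos psi * e1 - sin psi * e2 - a) ^+ 2 +
  (sin psi * e1 + cos psi * e2 - b) ^+ 2 <= l ^+ 2.

(** Two points of a disk are at distance at most 2 l, and on the unit circle
    the distance is twice the sine of half the angle. *)
Lemma covers_angle_diam e1 e2 a b l psi psi' : e1 ^+ 2 + e2 ^+ 2 = 1 -> 0 <= l ->
  covers_angle e1 e2 a b l psi -> covers_angle e1 e2 a b l psi' ->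
  `|sin ((psi - psi') / 2)| <= l.
Proof.
move=> e12 l0; rewrite /covers_angle => n1 n2.
rewrite -(@ler_pXn2r _ 2) ?nnegrE// real_normK ?num_real//.
have cosE : cos (psi - psi') = 1 - 2 * sin ((psi - psi') / 2) ^+ 2.
  have {1}-> : psi - psi' = (psi - psi') / 2 *+ 2 by rewrite mulr2n; field.
  by rewrite cos_mulr2n cos2sin2 mulr2n; ring.
have cs := cos2Dsin2 psi; have cs' := cos2Dsin2 psi'.
rewrite cosB in cosE.
move: cs cs' cosE n1 n2; set s := sin (_ / 2).
move: (cos psi) (sin psi) (cos psi') (sin psi') => x y x' y' cs cs' cosE n1 n2.
have distE : (x * e1 - y * e2 - (x' * e1 - y' * e2)) ^+ 2 +
  (y * e1 + x * e2 - (y' * e1 + x' * e2)) ^+ 2 = 4 * s ^+ 2.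
  transitivity (((x ^+ 2 + y ^+ 2) + (x' ^+ 2 + y' ^+ 2) -
    2 * (x * x' + y * y')) * (e1 ^+ 2 + e2 ^+ 2)); first by ring.
  by rewrite e12 cs cs' cosE; ring.
have par (p q a0 : R) : (p - q) ^+ 2 <= 2 * (p - a0) ^+ 2 + 2 * (q - a0) ^+ 2.
  by have := sqr_ge0 (p + q - 2 * a0); lra.
have := par (x * e1 - y * e2) (x' * e1 - y' * e2) a.
have := par (y * e1 + x * e2) (y' * e1 + x' * e2) b.
lra.
Qed.

Lemma covers_angle_cont (e1 e2 a b : R) :
  continuous (fun psi : R => (cos psi * e1 - sin psi * e2 - a) ^+ 2 +
    (sin psi * e1 + cos psi * e2 - b) ^+ 2).
Proof.
have cc (k : R) : continuous (fun _ : R => k) by move=> x; exact: cvg_cst.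
have cD (f g : R -> R) : continuous f -> continuous g -> continuous (fun x => f x + g x).
  by move=> cf cg x; apply: cvgD; [exact: cf|exact: cg].
have cs := @continuous_sin R; have co := @continuous_cos R.
apply: (cD _ _); apply: cont_mul; apply: cont_sub => //.
- by apply: cont_sub; apply: cont_mul.
- by apply: cont_sub; apply: cont_mul.
- by apply: (cD _ _); apply: cont_mul.
- by apply: (cD _ _); apply: cont_mul.
Qed.

Lemma covers_angle_closed e1 e2 a b l (d : R) :
  closed [set phi | covers_angle e1 e2 a b l (phi + d)].
Proof.
apply: (@preimage_closed _ _ (fun phi => (cos (phi + d) * e1 - sin (phi + d) * e2 - a) ^+ 2 +
  (sin (phi + d) * e1 + cos (phi + d) * e2 - b) ^+ 2) [set x | x <= l ^+ 2]).
  move=> phi _; apply: (@cont_comp _ _ _ (fun phi => phi + d)) (@covers_angle_cont e1 e2 a b) phi.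
  by move=> x; apply: cvgD; [exact: cvg_id|exact: cvg_cst].
exact: closed_le.
Qed.

(** As the n-gon turns with its first vertex going from angle eta to
    2 pi / n - eta, pigeonhole gives each disk exactly one vertex.  The turns
    at which a given disk holds its initial vertex and those at which it holds
    another one form disjoint closed sets, so the second set is empty; but the
    first and last positions of the vertex are more than 2 l apart. *)
Lemma rotating_polygon (n : nat) (I : finType) (a b : I -> R) (e1 e2 l eta : R) :
  (1 < n)%N -> (#|I| <= n)%N -> e1 ^+ 2 + e2 ^+ 2 = 1 ->
  0 <= eta <= pi / n%:R -> 0 <= l < sin (pi / n%:R) -> l < sin (pi / n%:R - eta) ->
  (forall psi, eta <= psi <= 2 * pi - eta ->
    exists i, covers_angle e1 e2 (a i) (b i) l psi) -> False.
Proof.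
case: n => // n n1 In e12 eta0 l0 l1 cov.
pose x : R := pi / n.+1%:R.
rewrite -/x in eta0 l0 l1.
have nx : n.+1%:R * x = pi by rewrite /x mulrC divfK// pnatr_eq0.
have pi0 := @pi_gt0 R.
have x0 : 0 < x by rewrite divr_gt0.
pose v (j : 'I_n.+1) := (j : nat)%:R * (2 * x).
pose beta := 2 * x - eta.
have eb : eta <= beta by rewrite /beta; lra.
have vrange phi j : eta <= phi <= beta -> eta <= phi + v j <= 2 * pi - eta.
  have j0 : 0 <= (j : nat)%:R :> R by [].
  have jn : (j : nat)%:R + 1 <= n.+1%:R :> R by rewrite natr1 ler_nat ltn_ord.
  have vj0 : 0 <= v j by rewrite /v mulr_ge0//; lra.
  have vjn : v j + 2 * x <= 2 * pi.
    by rewrite -nx; have := ler_wpM2r (ltW x0) jn; rewrite /v; lra.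
  rewrite /beta; lra.
have sep phi i j k : covers_angle e1 e2 (a i) (b i) l (phi + v j) ->
    covers_angle e1 e2 (a i) (b i) l (phi + v k) -> j = k.
  move=> nj nk; apply/eqP; apply: contraT => jk.
  wlog lt_kj : j k nj nk jk / (k < j)%N.
    move=> h; case: (ltngtP j k) jk => [jk ne|kj ne|/val_inj->]; last by rewrite eqxx.
      by apply: (h k j) => //; rewrite eq_sym.
    exact: (h j k).
  have := covers_angle_diam e12 _ nj nk.
  have -> : (phi + v j - (phi + v k)) / 2 = (j - k)%:R * x.
    by rewrite natrB 1?ltnW// /v; field.
  have [l00 _] := andP l0; move/(_ l00).
  have d0 : (0 < j - k < n.+1)%N.
    by rewrite subn_gt0 lt_kj /= (leq_ltn_trans (leq_subr _ _)).
  have := @sin_polygon_min R _ _ n1 d0; rewrite -/x => h1 h2.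
  have : `|sin ((j - k)%:R * x)| < sin x.
    by apply: le_lt_trans h2 _; case/andP: l0.
  by rewrite ltNge (le_trans h1)// ler_norm.
have all_hit phi i : eta <= phi <= beta ->
    exists j, covers_angle e1 e2 (a i) (b i) l (phi + v j).
  move=> phi_in; have /choice[f fP] j := cov _ (vrange phi j phi_in).
  have finj : injective f.
    move=> j k fjk; apply: (@sep phi (f j)); first exact: fP.
    by rewrite fjk; exact: fP.
  have := inj_card_onto finj _ i; rewrite card_ord => /(_ In) /codomP[j ->].
  by exists j; exact: fP.
have v0 : v ord0 = 0 by rewrite /v mul0r.
have eta_in : eta <= eta <= beta by rewrite lexx.
have [i ni] := cov _ (vrange eta ord0 eta_in).
pose T := [set phi | covers_angle e1 e2 (a i) (b i) l (phi + v ord0)].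
pose T' := \bigcup_(j in [set j : 'I_n.+1 | j != ord0])
  [set phi | covers_angle e1 e2 (a i) (b i) l (phi + v j)].
have clT : closed T by exact: covers_angle_closed.
have clT' : closed T'.
  apply: closed_bigcup => [|j _]; last exact: covers_angle_closed.
  exact: finite_finset.
have [[phi T'phi]|noT'] := pselect (`[eta, beta] `&` T' !=set0).
  have [|||s s_in [Ts [j /= j0 jTs]]] := @segment_closed_cover _ eta beta T T' clT clT'.
  - move=> s /=; rewrite in_itv /= => s_in; have [j nj] := all_hit s i s_in.
    have [j0|j0] := eqVneq j ord0; first by left; rewrite /T /= -j0.
    by right; exists j.
  - by exists eta; split=> //=; rewrite in_itv.
  - by exists phi.
  - by move/eqP: j0; apply; exact: (sep s i).
have beta_in : eta <= beta <= beta by rewrite lexx andbT.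
have [j nj] := all_hit beta i beta_in.
have j0 : j = ord0.
  apply/eqP; apply: contra_notT noT' => j0; exists beta; split; first by rewrite /= in_itv.
  by exists j.
rewrite j0 v0 addr0 in nj; rewrite v0 addr0 in ni.
have [l00 _] := andP l0.
have := covers_angle_diam e12 l00 nj ni.
have -> : (beta - eta) / 2 = x - eta by rewrite /beta; field.
by apply/negP; rewrite -ltNge (lt_le_trans l1)// ler_norm.
Qed.

End Polygon.

(** * The covering index of the disk *)

Section Disk.
Variables (R : realType).
Notation V := 'rV[R]_2.
Implicit Types (c x : V).

(** The disk covering the centre is the one to be discarded.  Its own centre
    lies at distance d <= l in the direction (e1, e2), and it misses all points
    of the unit circle at angle at least eta from this direction, since
    1 - 2 d cos eta + d^2 decreases in d up to l <= cos eta and exceeds l^2 at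
    d = l. *)
Lemma unit_disk_not_covered (n m : nat) (a b : 'I_m -> R) (l eta : R) :
  (1 < n)%N -> (m <= n.+1)%N -> 0 <= eta <= pi / n%:R ->
  0 <= l < sin (pi / n%:R) -> l < sin (pi / n%:R - eta) ->
  2 * l * cos eta < 1 -> l <= cos eta ->
  ~ (forall x y : R, x ^+ 2 + y ^+ 2 <= 1 ->
       exists i, (x - a i) ^+ 2 + (y - b i) ^+ 2 <= l ^+ 2).
Proof.
move=> n1 mn eta0 l0 l1 l2 l3 cov.
have [|i0] := cov 0 0; first by rewrite expr0n addr0 ler01.
rewrite !sub0r !sqrrN => i0E.
pose d := Num.sqrt (a i0 ^+ 2 + b i0 ^+ 2).
have d0 : 0 <= d by exact: sqrtr_ge0.
have d2 : d ^+ 2 = a i0 ^+ 2 + b i0 ^+ 2 by rewrite sqr_sqrtr// addr_ge0 ?sqr_ge0.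
have dl : d <= l.
  by case/andP: l0 => ? _; rewrite -(@ler_pXn2r _ 2) ?nnegrE// d2.
have [e1 [e2 [e12 aE bE]]] : exists e1 e2,
    [/\ e1 ^+ 2 + e2 ^+ 2 = 1, a i0 = d * e1 & b i0 = d * e2].
  have [d00|dn0] := eqVneq d 0.
    exists 1, 0; rewrite d00 !mul0r expr1n expr0n addr0; move/eqP: d2.
    rewrite d00 expr0n /= eq_sym paddr_eq0 ?sqr_ge0// !sqrf_eq0.
    by case/andP => /eqP -> /eqP ->.
  exists (a i0 / d), (b i0 / d); split; [|by rewrite mulrC divfK..].
  by rewrite !expr_div_n -mulrDl -d2 divff// expf_neq0.
have npi : pi / n%:R <= pi :> R.
  have n0 : 1 <= n%:R :> R by rewrite ler1n ltnW.
  by rewrite ler_pdivrMr ?(lt_le_trans ltr01)// ler_peMr// ltW// pi_gt0.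
have far psi : eta <= psi <= 2 * pi - eta ->
    ~ covers_angle e1 e2 (a i0) (b i0) l psi.
  move=> psi_in; rewrite /covers_angle aE bE; apply/negP; rewrite -ltNge.
  have -> : (cos psi * e1 - sin psi * e2 - d * e1) ^+ 2 +
    (sin psi * e1 + cos psi * e2 - d * e2) ^+ 2 = 1 - 2 * d * cos psi + d ^+ 2.
    have cs := cos2Dsin2 psi.
    transitivity ((cos psi ^+ 2 + sin psi ^+ 2 - 2 * d * cos psi + d ^+ 2) *
      (e1 ^+ 2 + e2 ^+ 2)); first by ring.
    by rewrite e12 cs mulr1.
  have cc : cos psi <= cos eta by apply: cos_le_away psi_in; lra.
  have : 0 <= d * (cos eta - cos psi) by apply: mulr_ge0; lra.
  have : 0 <= (l - d) * (2 * cos eta - l - d) by apply: mulr_ge0; lra.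
  lra.
pose I := {i : 'I_m | i != i0}.
apply: (@rotating_polygon R n I (fun i => a (val i)) (fun i => b (val i)) e1 e2 l eta) => //.
  rewrite card_sig; have := cardC1 i0; rewrite card_ord.
  have -> : #|[pred i | i != i0]| = #|predC1 i0| by apply: eq_card.
  by move=> ->; rewrite -ltnS; case: (m) mn i0 {i0E d d0 d2 dl aE bE far I} => [? []|k].
move=> psi psi_in.
have [|i ni] := cov (cos psi * e1 - sin psi * e2) (sin psi * e1 + cos psi * e2).
  have -> : (cos psi * e1 - sin psi * e2) ^+ 2 + (sin psi * e1 + cos psi * e2) ^+ 2 =
    (cos psi ^+ 2 + sin psi ^+ 2) * (e1 ^+ 2 + e2 ^+ 2) by ring.
  by rewrite cos2Dsin2 e12 mulr1.
have ii0 : i != i0 by apply: contra_notN (far psi psi_in) => /eqP <-.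
by exists (exist _ i ii0).
Qed.

Lemma diskE c r x : 0 <= r ->
  disk c r x <-> (x 0 0 - c 0 0) ^+ 2 + (x 0 1 - c 0 1) ^+ 2 <= r ^+ 2.
Proof.
move=> r0; rewrite /disk /= !big_ord_recl big_ord0 addr0.
have -> : lift ord0 ord0 = 1 :> 'I_2 by apply/val_inj.
set s := _ + _; have s0 : 0 <= s by rewrite addr_ge0 ?sqr_ge0.
by rewrite -(@ler_pXn2r _ 2 _ (Num.sqrt s)) ?nnegrE ?sqrtr_ge0// sqr_sqrtr.
Qed.

Lemma disk_cover_unit c r m l (t : 'I_m -> V) : 0 < r -> 0 < l ->
  disk c r `<=` \bigcup_(i in [set: 'I_m]) homothet (disk c r) l (t i) ->
  exists a b : 'I_m -> R, forall x y : R, x ^+ 2 + y ^+ 2 <= 1 ->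
       exists i, (x - a i) ^+ 2 + (y - b i) ^+ 2 <= l ^+ 2.
Proof.
move=> r0 l0 cov.
exists (fun i => ((l - 1) * c 0 0 + t i 0 0) / r), (fun i => ((l - 1) * c 0 1 + t i 0 1) / r).
move=> x y xy.
pose z : V := c + (r * x) *: delta_mx 0 0 + (r * y) *: delta_mx 0 1.
have z0 : z 0 0 = c 0 0 + r * x by rewrite !mxE /=; ring.
have z1 : z 0 1 = c 0 1 + r * y by rewrite !mxE /=; ring.
have [|i _ [w wD wz]] := cov z.
  apply/(diskE _ _ (ltW r0)); rewrite z0 z1.
  have -> : (c 0 0 + r * x - c 0 0) ^+ 2 + (c 0 1 + r * y - c 0 1) ^+ 2 =
    r ^+ 2 * (x ^+ 2 + y ^+ 2) by ring.
  by rewrite ler_piMr// sqr_ge0.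
exists i; move/(diskE _ _ (ltW r0)): wD => wD.
have xE : l * w 0 0 + t i 0 0 = c 0 0 + r * x by rewrite -z0 -wz !mxE.
have yE : l * w 0 1 + t i 0 1 = c 0 1 + r * y by rewrite -z1 -wz !mxE.
rewrite -(@ler_pM2l _ (r ^+ 2)) ?exprn_gt0//.
have -> : r ^+ 2 * ((x - ((l - 1) * c 0 0 + t i 0 0) / r) ^+ 2 +
   (y - ((l - 1) * c 0 1 + t i 0 1) / r) ^+ 2) =
   (r * x - (l - 1) * c 0 0 - t i 0 0) ^+ 2 + (r * y - (l - 1) * c 0 1 - t i 0 1) ^+ 2.
  by field; lra.
have -> : r * x - (l - 1) * c 0 0 - t i 0 0 = l * (w 0 0 - c 0 0) by lra.
have -> : r * y - (l - 1) * c 0 1 - t i 0 1 = l * (w 0 1 - c 0 1) by lra.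
by rewrite !exprMn -mulrDr mulrC ler_wpM2r ?sqr_ge0.
Qed.

Lemma sqdist_cont c :
  continuous (fun x : V => (x 0 0 - c 0 0) ^+ 2 + (x 0 1 - c 0 1) ^+ 2).
Proof.
have coord i : continuous (fun x : V => x 0 i - c 0 i).
  by apply: cont_sub; [exact: coord_continuous|exact: cst_continuous].
have cD (f g : V -> R) : continuous f -> continuous g -> continuous (fun x => f x + g x).
  by move=> cf cg x; have := @continuousD _ _ _ f g x (cf x) (cg x).
by apply: (cD _ _); apply: cont_mul.
Qed.

Lemma disk_convex_body c r : 0 < r -> planar_convex_body (disk c r).
Proof.
move=> r0; have r0' := ltW r0.
have -> : disk c r = [set x | (x 0 0 - c 0 0) ^+ 2 + (x 0 1 - c 0 1) ^+ 2 <= r ^+ 2].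
  by apply/seteqP; split=> x /(diskE _ _ r0').
split.
- apply: bounded_closed_compact; last first.
    apply: (@preimage_closed _ _ (fun x : V =>
      (x 0 0 - c 0 0) ^+ 2 + (x 0 1 - c 0 1) ^+ 2) [set d | d <= r ^+ 2]).
      by move=> x _; exact: sqdist_cont.
    exact: closed_le.
  exists (`|c| + r); split; first exact: num_real.
  move=> M cM x /= xr; apply: le_trans (ltW cM).
  apply: norm_le_coord => [|i]; first by rewrite addr_ge0.
  have xi : `|x 0 i - c 0 i| <= r.
    rewrite -(@ler_pXn2r _ 2) ?nnegrE// real_normK ?num_real//.
    have := sqr_ge0 (x 0 0 - c 0 0); have := sqr_ge0 (x 0 1 - c 0 1).
    by case: (ord2 i) => ->; lra.
  rewrite -[x 0 i](subrK (c 0 i)) addrC (le_trans (ler_normD _ _))//.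
  by rewrite lerD ?coord_le_norm.
- move=> x y t; rewrite !inE /= => xr yr; rewrite !mxE /unstable.onem.
  have s0 : 0 <= t%:num by [].
  have s1 : 0 <= 1 - t%:num by rewrite subr_ge0.
  move: (t%:num) s0 s1 => s s0 s1.
  have jensen (p q : R) : (s * p + (1 - s) * q) ^+ 2 <= s * p ^+ 2 + (1 - s) * q ^+ 2.
    rewrite -subr_ge0.
    have -> : s * p ^+ 2 + (1 - s) * q ^+ 2 - (s * p + (1 - s) * q) ^+ 2 =
      s * (1 - s) * (p - q) ^+ 2 by ring.
    by rewrite mulr_ge0 ?sqr_ge0 ?mulr_ge0.
  have comb i : s * x 0 i + (1 - s) * y 0 i - c 0 i =
    s * (x 0 i - c 0 i) + (1 - s) * (y 0 i - c 0 i) by ring.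
  rewrite !comb; apply: le_trans (lerD (jensen _ _) (jensen _ _)) _.
  have := ler_wpM2l s1 yr.
  by have := ler_wpM2l s0 xr; lra.
- exists c; have := @sqdist_cont c c => /cvgr_lt; rewrite /= !subrr expr0n addr0 /=.
  move=> /(_ (r ^+ 2)); rewrite exprn_gt0// => /(_ isT) h.
  by rewrite /interior /=; apply: filterS h => x /ltW.
Qed.

Lemma gamma_ge (K : set V) m L : (0 < m)%N ->
  (forall l (t : 'I_m -> V), 0 < l ->
    K `<=` \bigcup_(i in [set: 'I_m]) homothet K l (t i) -> L <= l) ->
  L <= gamma m K.
Proof.
move=> m0 lb; apply: lb_le_inf; last by move=> l [l0 [t]]; exact: lb.
exists 1; split=> //; exists (fun=> 0) => x Kx.
by exists (Ordinal m0) => //; exists x => //; rewrite scale1r addr0.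
Qed.

Lemma gamma_disk_ge c r (n m : nat) (eta L : R) : 0 < r -> (0 < m)%N ->
  (1 < n)%N -> (m <= n.+1)%N -> 0 <= eta <= pi / n%:R ->
  L <= sin (pi / n%:R) -> L <= sin (pi / n%:R - eta) ->
  2 * L * cos eta <= 1 -> L <= cos eta -> L <= gamma m (disk c r).
Proof.
move=> r0 m0 n1 mn eta0 L1 L2 L3 L4; apply: gamma_ge => // l t l0 cov.
rewrite leNgt; apply/negP => lL.
have [a [b ab]] := disk_cover_unit r0 l0 cov.
apply: (unit_disk_not_covered n1 mn eta0 _ _ _ _ ab); try lra.
apply: lt_le_trans L3; rewrite -!mulrA ltr_pM2l// ltr_pM2r//; lra.
Qed.

(** A pentagon leaves room: the tolerance eta = pi / 60 around the discarded
    disk keeps pi / 5 - eta above pi / 6, so that [unit_disk_not_covered]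
    holds for radii up to some L > 1/2. *)
Lemma gamma_disk_gt_half c r m : 0 < r -> (0 < m <= 6)%N ->
  1 / 2 < gamma m (disk c r).
Proof.
move=> r0 /andP[m0 m6]; have pi0 := @pi_gt0 R.
pose eta : R := pi / 60.
have cos_lt1 : cos eta < 1.
  by rewrite -cos0 ltr_cos ?in_itv /= /eta; lra.
have cos_gt : 1 / 2 < cos eta.
  rewrite -sin_pi6 -cosBpihalf.
  have -> : pi / 6 - pi / 2 = - (pi / 3) :> R by field.
  by rewrite cosN ltr_cos ?in_itv /= /eta; lra.
have sin_gt : 1 / 2 < sin (pi / 5%:R - eta).
  by rewrite -sin_pi6 ltr_sin ?in_itv /= /eta; lra.
pose L := Num.min (1 / (2 * cos eta)) (Num.min (sin (pi / 5%:R - eta)) (cos eta)).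
apply: (@lt_le_trans _ _ L).
  rewrite /L !lt_min sin_gt cos_gt !andbT ltr_pdivlMr; lra.
have [L1 L2 L3] : [/\ L <= 1 / (2 * cos eta), L <= sin (pi / 5%:R - eta) & L <= cos eta].
  by rewrite /L !ge_min !lexx !orbT.
apply: (@gamma_disk_ge c r 5 m eta L) => //.
- by rewrite /eta; lra.
- by apply: le_trans L2 _; apply: sin_mono; rewrite /eta; lra.
- by move: L1; rewrite ler_pdivlMr; lra.
Qed.

Lemma gamma_disk_ge_linear c r m : 0 < r -> (7 <= m <= 13)%N ->
  1 - m%:R / 14 <= gamma m (disk c r).
Proof.
move=> r0 /andP[m7 m13]; have pi0 := @pi_gt0 R.
case: m m7 m13 => // n; rewrite !ltnS => n6 n12.
have n6' : 6 <= n%:R :> R by rewrite ler_nat.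
have bound : 1 - n.+1%:R / 14 <= 3 / n%:R :> R.
  rewrite -natr1 ler_pdivlMr; last lra.
  (* (13 - n) / 14 <= 3 / n amounts to (n - 6) (n - 7) >= 0, which holds at
     integers *)
  have : 0 <= (n%:R - 6) * (n%:R - 7) :> R.
    move: n6; rewrite leq_eqVlt => /predU1P[<-|n7]; first by rewrite subrr mul0r.
    by have n7' : 7 <= n%:R :> R; [rewrite ler_nat|apply: mulr_ge0; lra].
  lra.
have le_sin : 1 - n.+1%:R / 14 <= sin (pi / n%:R) :> R.
  apply: le_trans bound _.
  have -> : 3 / n%:R = 3 / pi * (pi / n%:R) :> R by field; lra.
  apply: sin_ge_chord; rewrite divr_ge0//= ?ler_pdivrMr; nra.
have n7 : 7 <= n.+1%:R :> R by rewrite ler_nat.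
apply: (@gamma_disk_ge c r n n.+1 0) => //; rewrite ?subr0 ?cos0//; try lra.
- by rewrite (leq_trans _ n6).
- by rewrite lexx divr_ge0//; lra.
Qed.

Lemma coin_disk_ge14 c r : 0 < r -> (14%:E <= coin (disk c r))%E.
Proof.
move=> r0; apply/ereal_infP => _ [m [m0 mhalf] <-].
have g1 : 0 < 1 - gamma m (disk c r) by lra.
rewrite lee_fin ler_pdivlMr//.
have [m6|m7] := leqP m 6.
  by have := @gamma_disk_gt_half c r m r0; rewrite m0 m6 => /(_ isT); lra.
have [m13|m14] := leqP m 13.
  have := @gamma_disk_ge_linear c r m r0; rewrite m7 m13 => /(_ isT); lra.
have : 0 <= gamma m (disk c r) by apply: gamma_ge => // l t /ltW.
have : 14 <= m%:R :> R by rewrite ler_nat.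
lra.
Qed.

End Disk.

Theorem theorem5p2 (R : realType) (K : set 'rV[R]_2) (c : 'rV[R]_2) (r : R) :
  planar_convex_body K -> (0 < r)%R ->
  (coin K <= coin (disk c r))%E /\ coin (disk c r) = 14%:E.
Proof.
move=> bK r0.
have -> : coin (disk c r) = 14%:E.
  apply/eqP; rewrite eq_le coin_disk_ge14// andbT.
  exact/coin_le14/disk_convex_body.
by split=> //; exact: coin_le14.
Qed.
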